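(* Let $P_{Y|X}$ be a discrete memoryless channel (DMC) with finite input alphabet $\mathcal{X}$ and finite output alphabet $\mathcal{Y}$. Fix a positive integer $M$, positive constants $\gamma_1<\gamma_2$, $a_{\mathrm{A}}$ and $a_{\mathrm{R}}$, a number $\epsilon_0\in(0,1)$, and a capacity-achieving input distribution $P_X$ (i.e. $I(P_X,P_{Y|X})=C$). Define $$(x_{\mathrm{A}},x_{\mathrm{R}})\in\arg\max_{(x,x')\in\mathcal{X}^2} D(P_{Y|X=x}\,\|\,P_{Y|X=x'}).$$ Let $(X,Y)\sim P_XP_{Y|X}$, $Y_{\mathrm{A}}\sim P_{Y|X=x_{\mathrm{A}}}$, $Y_{\mathrm{R}}\sim P_{Y|X=x_{\mathrm{R}}}$, and set $$b=b(\imath(X;Y)),\quad b_{\mathrm{A}}=b\Big(\log\frac{P_{Y|X=x_{\mathrm{A}}}(Y_{\mathrm{A}})}{P_{Y|X=x_{\mathrm{R}}}(Y_{\mathrm{A}})}\Big),\quad b_{\mathrm{R}}=b\Big(\log\frac{P_{Y|X=x_{\mathrm{R}}}(Y_{\mathrm{R}})}{P_{Y|X=x_{\mathrm{A}}}(Y_{\mathrm{R}})}\Big).$$ Define $$\epsilon'=(M-1)\big(e^{-(\gamma_1+a_{\mathrm{A}})}+e^{-\gamma_2}\big),$$ $$N'=\frac{\gamma_1+b}{C}+\big((M-1)e^{-\gamma_1}+e^{-a_{\mathrm{R}}}\big)\frac{\gamma_2-\gamma_1+b}{C}+\frac{a_{\mathrm{A}}+b_{\mathrm{A}}}{D(P_{Y|X=x_{\mathrm{A}}}\|P_{Y|X=x_{\mathrm{R}}})}+(M-1)e^{-\gamma_1}\frac{a_{\mathrm{R}}+b_{\mathrm{R}}}{D(P_{Y|X=x_{\mathrm{R}}}\|P_{Y|X=x_{\mathrm{A}}})}.$$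 Then there exists an $(N,M,\epsilon)$-VLF code for $P_{Y|X}$ with $$N\le(1-\epsilon_0)N',\qquad \epsilon\le \epsilon_0+(1-\epsilon_0)\epsilon'.$$
   Context: All logarithms are natural. The information density is $\imath(x;y)=\log\frac{P_{Y|X}(y|x)}{P_Y(y)}$, where $P_Y$ is the output distribution induced by $P_X$ and $P_{Y|X}$; $I(P_X,P_{Y|X})$ is the mutual information and $C=\max_{P_X}I(P_X,P_{Y|X})$ the capacity; $D(\cdot\|\cdot)$ is the Kullback–Leibler divergence. For a real random variable $Z$, $b(Z)\triangleq\min\big\{\frac{\mathbb{E}[(Z^+)^2]}{\mathbb{E}[Z]},\ \operatorname{ess\,sup} Z\big\}$. The DMC acts memorylessly: $P_{Y^n|X^n}(y^n|x^n)=\prod_i P_{Y|X}(y_i|x_i)$, and noiseless feedback of past outputs is available to the encoder. An $(N,M,\epsilon)$-VLF (variable-length feedback) code, for $N>0$, $M\in\mathbb{N}$, $\epsilon\in(0,1)$, consists of: (1) a common randomness random variable $U$ on a finite alphabet $\mathcal{U}$ with distribution $P_U$, revealed to transmitter and receiver before transmission; (2) encoding functions $\mathsf{f}_t:\mathcal{U}\times[M]\times\mathcal{Y}^{t-1}\to\mathcal{X}$ with $X_t=\mathsf{f}_t(U,W,Y^{t-1})$, $t\in\mathbb{N}$, where $W$ is the message, uniform on $[M]=\{1,\dots,M\}$; (3) a stopping time $\tau\in\mathbb{N}$ with respect to the filtration generated by $\{U,Y^t\}_{t\ge0}$ satisfying $\mathbb{E}[\tau]\le N$; (4) a decoding function producing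 $\hat W=\mathsf{g}_\tau(U,Y^\tau)\in[M]$ with $\Pr[\hat W\ne W]\le\epsilon$. (The code may depend on the channel $P_{Y|X}$.)
   Formalization: Assumes C>0 and that all rows of the channel are mutually absolutely continuous, i.e. the maximal divergence is finite (this excludes e.g. erasure and Z-channels); otherwise b_A and the quotients by C or by D(P_{Y|X=x_A}||P_{Y|X=x_R}) in N' are undefined (infinity over infinity, or division by 0). *)

(* Defs.v *)
From mathcomp Require Import all_boot all_order all_algebra.
From mathcomp Require Import reals sequences exp.
Set Implicit Arguments. Unset Strict Implicit. Unset Printing Implicit Defensive.
Import Order.TTheory GRing.Theory Num.Theory.
Local Open Scope ring_scope.

Section Info.
Variables (R : realType) (X Y : finType).

Definition is_channel (W : X -> Y -> R) :=
  (forall x y, 0 <= W x y) /\ (forall x, \sum_(y : Y) W x y = 1).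

Definition is_distr (T : finType) (P : T -> R) :=
  (forall t, 0 <= P t) /\ \sum_(t : T) P t = 1.

Definition out_distr (PX : X -> R) (W : X -> Y -> R) (y : Y) : R :=
  \sum_(x : X) PX x * W x y.

Definition info_dens (PX : X -> R) (W : X -> Y -> R) (x : X) (y : Y) : R :=
  ln (W x y / out_distr PX W y).

(* mutual information I(P_X, W) (terms of probability zero contribute 0) *)
Definition mutual_info (PX : X -> R) (W : X -> Y -> R) : R :=
  \sum_(x : X) \sum_(y : Y) PX x * W x y * info_dens PX W x y.

(* KL divergence D(W(.|x) || W(.|x')) (finite under mutual absolute continuity) *)
Definition KLdiv (W : X -> Y -> R) (x x' : X) : R :=
  \sum_(y : Y) W x y * ln (W x y / W x' y).
End Info.

(* For a real random variable Z = z(T), T ~ p on a finite type: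
   E[Z], E[(Z^+)^2], ess sup Z (= max of z over the support of p;
   the mean is used as the seed of the max, which does not change it
   since the mean is at most the max over the support), and b(Z). *)
Section BFun.
Variables (R : realType) (T : finType) (p : T -> R) (z : T -> R).
Definition expect : R := \sum_(t : T) p t * z t.
Definition expect_pos_sq : R := \sum_(t : T) p t * (Num.max (z t) 0) ^+ 2.
Definition ess_sup_fin : R := \big[Num.max/expect]_(t | 0 < p t) z t.
Definition bfun : R := Num.min (expect_pos_sq / expect) ess_sup_fin.
End BFun.

(* Variable-length feedback codes.
   - common randomness U on 'I_k with distribution PU;
   - encoder enc u w ys : the channel input X_t = f_t(U,W,Y^{t-1}) where
     ys = Y^{t-1} (its length t-1 determines t);
   - stopping time tau = min { t >= 0 | stp u (Y^t) }, adapted to (U, Y^t);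
   - decoder dec u (Y^tau). *)
Section VLF.
Variables (R : realType) (X Y : finType) (W : X -> Y -> R) (M k : nat).
Variables (PU : 'I_k -> R) (enc : 'I_k -> 'I_M -> seq Y -> X)
  (stp : 'I_k -> seq Y -> bool) (dec : 'I_k -> seq Y -> 'I_M).

Definition joint_prob (t : nat) (u : 'I_k) (w : 'I_M) (y : t.-tuple Y) : R :=
  PU u / M%:R * \prod_(i < t) W (enc u w (take i y)) (tnth y i).

Definition not_stopped (t : nat) (u : 'I_k) (y : t.-tuple Y) : bool :=
  [forall i : 'I_t.+1, ~~ stp u (take i y)].

Definition stops_at (t : nat) (u : 'I_k) (y : t.-tuple Y) : bool :=
  stp u y && [forall i : 'I_t, ~~ stp u (take i y)].

Definition prob_tau_gt (t : nat) : R :=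
  \sum_(u : 'I_k) \sum_(w : 'I_M) \sum_(y : t.-tuple Y)
     (if not_stopped u y then joint_prob u w y else 0).

Definition prob_err_at (t : nat) : R :=
  \sum_(u : 'I_k) \sum_(w : 'I_M) \sum_(y : t.-tuple Y)
     (if stops_at u y && (dec u y != w) then joint_prob u w y else 0).

(* (N, M, eps)-VLF code: E[tau] = sum_t P[tau > t] <= N and
   P[hat W <> W] = sum_t P[tau = t, hat W <> W] <= eps (partial sums of
   nonnegative series bounded, i.e. the series are bounded; E[tau] <= N
   forces tau < oo a.s., so the error sum is the full error probability). *)
Definition is_VLF_code (N eps : R) : Prop :=
  is_distr PU /\
  (forall T : nat, \sum_(t < T) prob_tau_gt t <= N) /\
  (forall T : nat, \sum_(t < T) prob_err_at t <= eps).
End VLF.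

Definition exists_VLF_code (R : realType) (X Y : finType) (W : X -> Y -> R)
  (N : R) (M : nat) (eps : R) : Prop :=
  [/\ 0 < N, 0 < eps, eps < 1 &
   exists (k : nat) (PU : 'I_k -> R) (enc : 'I_k -> 'I_M -> seq Y -> X)
     (stp : 'I_k -> seq Y -> bool) (dec : 'I_k -> seq Y -> 'I_M),
     is_VLF_code W PU enc stp dec N eps].

(* Main.v *)
(* The receiver runs a random code until the information density of some message
   reaches [gamma1]; the transmitter, knowing that tentative decision through
   feedback, then sends [xA] if it is right and [xR] if it is wrong, while the
   receiver runs a sequential probability ratio test with thresholds [aA] and
   [- aR].  On rejection the random code is resumed up to level [gamma2].  Hitting
   times of random walks are bounded by Lorden's inequality, wrong messages by the
   likelihood-ratio martingale, and every expectation along the scheme by an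
   explicit potential function of the current state.

   The code stops at time [0] with probability [eps0].  A blind guess is then right
   with probability [1 / M], and this slack of [eps0 / M] in the error pays for
   truncating the scheme at a large time; so a finite random codebook suffices and
   all expectations are finite sums. *)
Require Import Defs.
From mathcomp Require Import all_boot all_order all_algebra.
From mathcomp Require Import reals sequences exp.
From mathcomp Require Import boolp classical_sets topology normedtype.
From mathcomp Require Import ring lra.
Import Order.TTheory GRing.Theory Num.Theory.
Import numFieldNormedType.Exports.
Set Implicit Arguments. Unset Strict Implicit. Unset Printing Implicit Defensive.
Local Open Scope ring_scope.

(** * Expectations on a finite probability space *)

Section Expectation.
Local Open Scope classical_set_scope.
Local Open Scope ring_scope.
Variables (R : realType) (T : finType) (p : T -> R).
Hypothesis p_distr : is_distr p.
Implicit Types f g : T -> R.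

Lemma expectD f g :
  expect p (fun t => f t + g t) = expect p f + expect p g.
Proof. by rewrite /expect -big_split; apply: eq_bigr => t _; rewrite mulrDr. Qed.

Lemma expectZ c f : expect p (fun t => c * f t) = c * expect p f.
Proof. by rewrite /expect mulr_sumr; apply: eq_bigr => t _; rewrite mulrCA. Qed.

Lemma expectB f g :
  expect p (fun t => f t - g t) = expect p f - expect p g.
Proof. by rewrite /expect -sumrB; apply: eq_bigr => t _; rewrite mulrBr. Qed.

Lemma expect_cst c : expect p (fun=> c) = c.
Proof. by rewrite /expect -mulr_suml p_distr.2 mul1r. Qed.

Lemma expect_sum (I : finType) (P : pred I) (F : I -> T -> R) :
  expect p (fun t => \sum_(i | P i) F i t) = \sum_(i | P i) expect p (F i).
Proof.
rewrite /expect exchange_big; apply: eq_bigr => t _.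
by rewrite mulr_sumr.
Qed.

Lemma eq_expect f g : f =1 g -> expect p f = expect p g.
Proof. by move=> fg; apply: eq_bigr => t _; rewrite fg. Qed.

Lemma le_expect f g :
  (forall t, 0 < p t -> f t <= g t) -> expect p f <= expect p g.
Proof.
move=> fg; apply: ler_sum => t _; have := p_distr.1 t.
rewrite le_eqVlt => /predU1P[<-|pt]; first by rewrite !mul0r.
by rewrite ler_pM2l// fg.
Qed.

Lemma expect_ge0 f : (forall t, 0 < p t -> 0 <= f t) -> 0 <= expect p f.
Proof. by move=> f0; rewrite -(expect_cst 0); apply: le_expect. Qed.

Lemma expect_sqr_le f : expect p f ^+ 2 <= expect p (fun t => f t ^+ 2).
Proof.
set m := expect p f.
have : 0 <= expect p (fun t => (f t - m) ^+ 2).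
  by apply: expect_ge0 => t _; exact: sqr_ge0.
have -> : expect p (fun t => (f t - m) ^+ 2)
        = expect p (fun t => f t ^+ 2 - (2 * m * f t - m ^+ 2)).
  by apply: eq_expect => t; ring.
rewrite expectB expectB expectZ expect_cst -/m; nra.
Qed.

Lemma cvg_expect (F : nat -> T -> R) f :
  (forall t, F n t @[n --> \oo] --> f t) ->
  expect p (F n) @[n --> \oo] --> expect p f.
Proof.
move=> Ff; apply: cvg_big => [|t _]; first exact: add_continuous.
by apply: cvgMl_tmp; exact: Ff.
Qed.

End Expectation.

(* Summing the increments of [H] over a grid of mesh [c / n] leaves an error
   [c / n * (m c - m 0)]. *)
Lemma grid_le0 (R : realType) (c : R) (H m : R -> R) :
  0 <= c -> H 0 <= 0 ->
  (forall u d, 0 <= u -> 0 <= d -> u + d <= c ->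
     H (u + d) - H u <= d * (m (u + d) - m u)) ->
  H c <= 0.
Proof.
move=> c0 H0 incr.
suff bound n : n.+1%:R * H c <= c * (m c - m 0).
  rewrite leNgt; apply/negP => Hc.
  set a := c * (m c - m 0) / H c.
  have := bound (Num.bound `|a|); apply/negP; rewrite -ltNge.
  have /archi_boundP := normr_ge0 a => ab.
  rewrite -ltr_pdivrMr//; apply: le_lt_trans (ler_norm _) _.
  by apply: lt_trans ab _; rewrite ltr_nat.
set d := c / n.+1%:R.
have d0 : 0 <= d by rewrite divr_ge0.
have dc : n.+1%:R * d = c by rewrite mulrC divfK// pnatr_eq0.
have grid k : (k <= n.+1)%N -> H (k%:R * d) <= d * (m (k%:R * d) - m 0).
  elim: k => [|k IH] kn; first by rewrite mul0r subrr mulr0.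
  have := IH (ltnW kn); have := incr (k%:R * d) d.
  have -> : k%:R * d + d = k.+1%:R * d by rewrite -natr1 mulrDl mul1r.
  rewrite mulr_ge0// d0 => /(_ isT isT).
  have kd : k.+1%:R * d <= c by rewrite -[leRHS]dc ler_wpM2r// ler_nat.
  by move=> /(_ kd); lra.
have := grid n.+1 (leqnn _); rewrite dc => Hc.
rewrite -[X in X * (m c - m 0)]dc -mulrA ler_wpM2l//.
Qed.

(** * Lorden's inequality for the mean hitting time *)

Section HittingTime.
Local Open Scope classical_set_scope.
Local Open Scope ring_scope.
Variables (R : realType) (T : finType) (p : T -> R) (z : T -> R).
Hypothesis p_distr : is_distr p.
Hypothesis mu_gt0 : 0 < expect p z.
Local Notation mu := (expect p z).
Local Notation B := (ess_sup_fin p z).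
Local Notation v := (expect_pos_sq p z).
Local Notation E := (expect p).
Implicit Types (u d c : R) (n : nat).

(* [E (min (tau, n))] for the first time [tau] at which the random walk with
   steps distributed as [z] under [p] reaches [u]. *)
Fixpoint hit_upto n u : R :=
  if n is n'.+1 then
    if 0 < u then 1 + E (fun t => hit_upto n' (u - z t)) else 0
  else 0.

Definition hit u : R := limn (hit_upto ^~ u).

Lemma ess_sup_ge t : 0 < p t -> z t <= B.
Proof. by move=> pt; apply: le_bigmax_cond. Qed.

Lemma mean_le_ess_sup : mu <= B.
Proof. exact: bigmax_ge_id. Qed.

Lemma ess_sup_gt0 : 0 < B.
Proof. exact: lt_le_trans mean_le_ess_sup. Qed.

Lemma hit_upto_le0 n u : u <= 0 -> hit_upto n u = 0.
Proof. by case: n => //= n; rewrite leNgt => /negbTE->. Qed.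

Lemma hit_uptoS n u : 0 < u ->
  hit_upto n.+1 u = 1 + E (fun t => hit_upto n (u - z t)).
Proof. by move=> /= ->. Qed.

Lemma hit_upto_ge0 n u : 0 <= hit_upto n u.
Proof.
elim: n u => //= n IH u; case: ifP => // _.
by rewrite addr_ge0// (expect_ge0 p_distr).
Qed.

Lemma hit_upto_leS n u : hit_upto n u <= hit_upto n.+1 u.
Proof.
elim: n u => [|n IH] u; first exact: hit_upto_ge0.
have [u0|u0] := leP u 0; first by rewrite !hit_upto_le0.
by rewrite !hit_uptoS// lerD2l (le_expect p_distr).
Qed.

Lemma le_hit_upto n u c : u <= c -> hit_upto n u <= hit_upto n c.
Proof.
elim: n u c => // n IH u c uc.
have [u0|u0] := leP u 0; first by rewrite hit_upto_le0// hit_upto_ge0.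
rewrite !hit_uptoS//; last exact: lt_le_trans uc.
by rewrite lerD2l (le_expect p_distr)// => t _; rewrite IH// lerD2r.
Qed.

(** Wald's argument: no step exceeds [B], so the stopped walk never passes [u + B]. The range starts
    at [- B] because [u - z t] may fall that low in the recursion. *)
Lemma hit_upto_le_sup n u : - B <= u -> mu * hit_upto n u <= u + B.
Proof.
elim: n u => [|n IH] u uB; first by rewrite mulr0 -lerBlDr sub0r.
have [u0|u0] := leP u 0; first by rewrite hit_upto_le0// mulr0 -lerBlDr sub0r.
rewrite hit_uptoS// mulrDr mulr1 -expectZ.
have : E (fun t => mu * hit_upto n (u - z t)) <= E (fun t => u + B - z t).
  apply: (le_expect p_distr) => t pt; rewrite addrAC IH//.
  by have := ess_sup_ge pt; lra.
by rewrite expectB (expect_cst p_distr); lra.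
Qed.

Lemma cvg_hit u : hit_upto n u @[n --> \oo] --> hit u.
Proof.
apply: nondecreasing_is_cvgn; first by apply/nondecreasing_seqP => k; exact: hit_upto_leS.
(* [Num.max u 0] brings any level into the range where the linear bound applies. *)
exists ((Num.max u 0 + B) / mu) => _ [n _ <-].
rewrite ler_pdivlMr// mulrC; have := ess_sup_gt0 => B0.
apply: le_trans (hit_upto_le_sup n (u := Num.max u 0) _); last first.
  by rewrite le_max; apply/orP; right; lra.
by rewrite ler_pM2l// le_hit_upto// le_max lexx.
Qed.

Arguments cvg_hit u : clear implicits.

Lemma hit_upto_le n u : hit_upto n u <= hit u.
Proof.
apply: nondecreasing_cvgn_le; first by apply/nondecreasing_seqP => k; exact: hit_upto_leS.
exact: cvg_hit.
Qed.

Lemma hit_le0 u : u <= 0 -> hit u = 0.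
Proof.
move=> u0; apply: (cvg_lim (@Rhausdorff R)).
rewrite (_ : hit_upto ^~ u = fun=> 0); first exact: cvg_cst.
by apply/funext => n; rewrite hit_upto_le0.
Qed.

Lemma hit_ge0 u : 0 <= hit u.
Proof. exact: (hit_upto_le 0). Qed.

Lemma le_hit u c : u <= c -> hit u <= hit c.
Proof.
move=> uc; apply: (ler_cvg_to (cvg_hit u) (cvg_hit c)).
by apply: nearW => n; exact: le_hit_upto.
Qed.

Lemma hitE u : 0 < u -> hit u = 1 + E (fun t => hit (u - z t)).
Proof.
move=> u0; apply: (cvg_lim (@Rhausdorff R)).
rewrite -cvg_shiftS (_ : [sequence _]_n =
  fun n => 1 + E (fun t => hit_upto n (u - z t))); last first.
  by apply/funext => n; rewrite -hit_uptoS.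
by apply: cvgD; [exact: cvg_cst|apply: cvg_expect => t; exact: cvg_hit].
Qed.

Lemma hit_ge1 u : 0 < u -> 1 <= hit u.
Proof.
move=> u0; rewrite hitE// lerDl.
by rewrite (expect_ge0 p_distr)// => t _; exact: hit_ge0.
Qed.

Lemma hit_le_sup u : 0 <= u -> mu * hit u <= u + B.
Proof.
move=> u0; apply: (ler_cvg_to (cvgMl_tmp (cvg_hit u)) (@cvg_cst _ (u + B) _ _ _)).
apply: nearW => n; apply: hit_upto_le_sup.
by have := ess_sup_gt0; lra.
Qed.

(** A step gains at most [B], so at least [u / B] steps are needed; [lb] is the version capped at
    [n] steps. *)
Lemma hit_ge_sup u : u <= B * hit u.
Proof.
have B0 := ess_sup_gt0.
have lb n : Num.min (n%:R * B) u <= B * hit_upto n u.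
  elim: n u => [|n IH] u; first by rewrite mul0r mulr0 ge_min lexx.
  have [u0|u0] := leP u 0; first by rewrite hit_upto_le0// mulr0 ge_min u0 orbT.
  have le1 : 1 + hit_upto n (u - B) <= hit_upto n.+1 u.
    rewrite hit_uptoS// lerD2l -(expect_cst p_distr (hit_upto n (u - B))).
    apply: (le_expect p_distr) => t pt; apply: le_hit_upto.
    by have := ess_sup_ge pt; lra.
  apply: le_trans (_ : B * (1 + hit_upto n (u - B)) <= _); last by rewrite ler_pM2l.
  have := IH (u - B); rewrite -natr1; set h := hit_upto _ _.
  by rewrite !ge_min => /orP[] ?; apply/orP; [left|right]; lra.
have /archi_boundP := divr_ge0 (normr_ge0 u) (ltW B0).
rewrite ltr_pdivrMr//; set n := Num.bound _ => un.
apply: le_trans (_ : B * hit_upto n u <= _); last by rewrite ler_pM2l// hit_upto_le.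
apply: le_trans (lb n).
by rewrite le_min lexx andbT; apply: le_trans (ler_norm u) (ltW un).
Qed.

(** To climb [u + c], first climb [u]; at most [c] then remains. *)
Lemma hit_subadd u c : 0 <= c -> hit (u + c) <= hit u + hit c.
Proof.
move=> c0.
have sub n : hit_upto n (u + c) <= hit_upto n u + hit c.
  elim: n u => [|n IH] u; first by rewrite add0r hit_ge0.
  have [u0|u0] := leP u 0.
    rewrite (hit_upto_le0 _ u0) add0r; apply: le_trans (hit_upto_le _ _) _.
    by apply: le_hit; lra.
  rewrite !hit_uptoS; [|exact: u0|exact: ltr_wpDr].
  rewrite -addrA lerD2l -(expect_cst p_distr (hit c)) -expectD.
  by apply: (le_expect p_distr) => t _; rewrite addrAC.
apply: (ler_cvg_to (cvg_hit (u + c)) (cvgD (cvg_hit u) (@cvg_cst _ (hit c) _ _ _))).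
by apply: nearW => n; exact: sub.
Qed.

(** A minimum principle in place of optional stopping: iterating the superharmonic inequality [n]
    times leaves the defect [K * (hit u - hit_upto n u)], which tends to 0. *)
Lemma min_principle (f : R -> R) (K : R) :
  0 <= K ->
  (forall u, u <= 0 -> 0 <= f u) ->
  (forall u, 0 < u -> - (K * hit u) <= f u) ->
  (forall u, 0 < u -> E (fun t => f (u - z t)) <= f u) ->
  forall u, 0 <= f u.
Proof.
move=> K0 f0 fK fE.
have lb n u : - (K * (hit u - hit_upto n u)) <= f u.
  elim: n u => [|n IH] u.
    have [u0|u0] := leP u 0; last by rewrite subr0 fK.
    by rewrite subr0 hit_le0// mulr0 oppr0 f0.
  have [u0|u0] := leP u 0.
    by rewrite hit_le0// hit_upto_le0// subr0 mulr0 oppr0 f0.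
  apply: le_trans (fE _ u0); rewrite hitE// hit_uptoS//.
  have -> : - (K * (1 + E (fun t => hit (u - z t)) -
      (1 + E (fun t => hit_upto n (u - z t)))))
    = E (fun t => - K * (hit (u - z t) - hit_upto n (u - z t))).
    by rewrite expectZ expectB; ring.
  by apply: (le_expect p_distr) => t _; rewrite mulNr.
move=> u.
have c1 : - (K * (hit u - hit_upto n u)) @[n --> \oo] --> - (K * (hit u - hit u)).
  by apply: cvgN; apply: cvgMl_tmp; apply: cvgB; [exact: cvg_cst|exact: cvg_hit].
have := ler_cvg_to c1 (@cvg_cst _ (f u) _ _ _).
rewrite subrr mulr0 oppr0; apply.
by apply: nearW => n; exact: lb.
Qed.

(* [int_0^u hit_upto n], given by the recursion that the integral satisfies, so
   that no integration theory is needed. *)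
Fixpoint area_upto n u : R :=
  if n is n'.+1 then
    if 0 < u then u + E (fun t => area_upto n' (u - z t) - area_upto n' (- z t))
    else 0
  else 0.

Definition area u : R := limn (area_upto ^~ u).

Lemma area_upto_le0 n u : u <= 0 -> area_upto n u = 0.
Proof. by case: n => //= n; rewrite leNgt => /negbTE->. Qed.

Lemma area_uptoS n u : 0 < u -> area_upto n.+1 u =
  u + E (fun t => area_upto n (u - z t) - area_upto n (- z t)).
Proof. by move=> /= ->. Qed.

(** The lower and upper one-rectangle bounds for the integral of a nondecreasing function; they make
    the recursion usable as an integral. *)
Lemma area_upto_incr n u d : 0 <= d ->
  d * hit_upto n u <= area_upto n (u + d) - area_upto n u <= d * hit_upto n (u + d).
Proof.
elim: n u d => [|n IH] u d d0; first by rewrite !mulr0 subrr lexx.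
have [w0|w0] := leP (u + d) 0.
  have u0 : u <= 0 by apply: le_trans w0; rewrite lerDl.
  by rewrite !area_upto_le0// !hit_upto_le0// !mulr0 subrr lexx.
(* If the interval straddles the origin, only [[0, w]] contributes, and [w <= d]. *)
have [u0|u0] := leP u 0.
  rewrite (area_upto_le0 _ u0) (hit_upto_le0 _ u0) mulr0 subr0.
  rewrite area_uptoS// hit_uptoS//; set w := u + d in w0 *.
  have lo : 0 <= E (fun t => area_upto n (w - z t) - area_upto n (- z t)).
    apply: (expect_ge0 p_distr) => t _; rewrite [w - z t]addrC.
    have /andP[+ _] := IH (- z t) w (ltW w0); apply: le_trans.
    by rewrite mulr_ge0 ?hit_upto_ge0 ?ltW.
  have hi : E (fun t => area_upto n (w - z t) - area_upto n (- z t)) <=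
            w * E (fun t => hit_upto n (w - z t)).
    rewrite -expectZ; apply: (le_expect p_distr) => t _; rewrite [w - z t]addrC.
    by have /andP[_] := IH (- z t) w (ltW w0).
  have h0 : 0 <= E (fun t => hit_upto n (w - z t)).
    by apply: (expect_ge0 p_distr) => t _; exact: hit_upto_ge0.
  rewrite addr_ge0 ?(ltW w0)//=.
  have wd : w <= d by rewrite /w gerDr.
  apply: le_trans (_ : w * (1 + E (fun t => hit_upto n (w - z t))) <= _).
    by rewrite mulrDr mulr1 lerD2l.
  by rewrite ler_wpM2r// addr_ge0.
rewrite !area_uptoS// !hit_uptoS//.
rewrite [X in _ <= X <= _](_ : _ =
    d + E (fun t => area_upto n (u - z t + d) - area_upto n (u - z t))); last first.
  have -> : E (fun t => area_upto n (u - z t + d) - area_upto n (u - z t)) =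
    E (fun t => (area_upto n (u + d - z t) - area_upto n (- z t)) -
                (area_upto n (u - z t) - area_upto n (- z t))).
    by apply: eq_expect => t; rewrite [u - z t + d]addrAC; ring.
  by rewrite [in RHS]expectB; ring.
rewrite !mulrDr !mulr1 !lerD2l -!expectZ; apply/andP; split;
  apply: (le_expect p_distr) => t _.
- by have /andP[] := IH (u - z t) d d0.
- by rewrite [u + d - z t]addrAC; have /andP[] := IH (u - z t) d d0.
Qed.

(** The recursion involves a difference of areas, so monotonicity in [n] is not inductive by itself.
    The inductive form says that a longer horizon adds more area at a higher level; base level 0
    then gives monotonicity. *)
Lemma area_upto_leS_incr n u d : 0 <= d ->
  area_upto n.+1 u - area_upto n u <= area_upto n.+1 (u + d) - area_upto n (u + d).
Proof.
elim: n u d => [|n IH] u d d0.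
  rewrite /= !subrr (expect_cst p_distr) !subr0 !addr0.
  by case: ltP => u0; case: ltP => // w0; lra.
have [w0|w0] := leP (u + d) 0.
  by rewrite !area_upto_le0//; apply: le_trans w0; rewrite lerDl.
have step w : 0 < w -> area_upto n.+2 w - area_upto n.+1 w =
  E (fun t => (area_upto n.+1 (w - z t) - area_upto n (w - z t))
              - (area_upto n.+1 (- z t) - area_upto n (- z t))).
  move=> w1; rewrite (area_uptoS n.+1)// (area_uptoS n)//.
  by rewrite opprD addrACA subrr add0r -expectB; apply: eq_expect => t; ring.
have [u0|u0] := leP u 0.
  rewrite !(area_upto_le0 _ u0) subrr step//.
  apply: (expect_ge0 p_distr) => t _; rewrite subr_ge0.
  by rewrite [u + d - z t]addrC IH// ltW.
rewrite !step//; apply: (le_expect p_distr) => t _; rewrite lerD2r.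
by rewrite [u + d - z t]addrAC IH.
Qed.

Lemma area_upto_leS n u : area_upto n u <= area_upto n.+1 u.
Proof.
have [u0|u0] := leP u 0; first by rewrite !area_upto_le0.
have := area_upto_leS_incr n 0 (ltW u0).
by rewrite add0r !(area_upto_le0 _ (lexx 0)) subrr subr_ge0.
Qed.

Lemma cvg_area u : area_upto n u @[n --> \oo] --> area u.
Proof.
apply: nondecreasing_is_cvgn.
  by apply/nondecreasing_seqP => k; exact: area_upto_leS.
exists (Num.max u 0 * hit u) => _ [n _ <-].
have [u0|u0] := leP u 0; first by rewrite area_upto_le0// mul0r.
have /andP[_] := area_upto_incr n 0 (ltW u0).
rewrite add0r (area_upto_le0 _ (lexx 0)) subr0 => /le_trans; apply.
by rewrite ler_pM2l// hit_upto_le.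
Qed.

Arguments cvg_area u : clear implicits.

Lemma area_le0 u : u <= 0 -> area u = 0.
Proof.
move=> u0; apply: (cvg_lim (@Rhausdorff R)).
rewrite (_ : area_upto ^~ u = fun=> 0); first exact: cvg_cst.
by apply/funext => n; rewrite area_upto_le0.
Qed.

Lemma areaE u : 0 < u ->
  area u = u + E (fun t => area (u - z t) - area (- z t)).
Proof.
move=> u0; apply: (cvg_lim (@Rhausdorff R)).
rewrite -cvg_shiftS (_ : [sequence _]_n = fun n =>
    u + E (fun t => area_upto n (u - z t) - area_upto n (- z t))); last first.
  by apply/funext => n; rewrite -area_uptoS.
apply: cvgD; first exact: cvg_cst.
by apply: cvg_expect => t; apply: cvgB; exact: cvg_area.
Qed.

Lemma area_incr_ge u d : 0 <= d -> d * hit u <= area (u + d) - area u.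
Proof.
move=> d0; have ch := @cvgMl_tmp _ _ _ _ _ d _ (cvg_hit u).
have ca := cvgB (cvg_area (u + d)) (cvg_area u).
apply: (ler_cvg_to (ch _) (ca _)).
by apply: nearW => n; have /andP[] := area_upto_incr n u d0.
Qed.

Lemma area_incr_le u d : 0 <= d -> area (u + d) - area u <= d * hit (u + d).
Proof.
move=> d0; have ch := @cvgMl_tmp _ _ _ _ _ d _ (cvg_hit (u + d)).
have ca := cvgB (cvg_area (u + d)) (cvg_area u).
apply: (ler_cvg_to (ca _) (ch _)).
by apply: nearW => n; have /andP[] := area_upto_incr n u d0.
Qed.

(* Subadditivity, integrated: [c hit c <= int_0^c (hit x + hit (c - x)) dx]. *)
Lemma area_ge c : 0 <= c -> c * hit c <= 2 * area c.
Proof.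
move=> c0.
(* [H u] compares the two sides integrated over [[0, u]] only; there [hit (c - x)] integrates to
   [area c - area (c - u)]. *)
pose H u := u * hit c - (area u + area c - area (c - u)).
suff : H c <= 0 by rewrite /H subrr (area_le0 (lexx 0)); lra.
apply: (@grid_le0 _ c _ hit) => //.
  by rewrite /H mul0r subr0 (area_le0 (lexx 0)); lra.
move=> u d u0 d0 udc; rewrite /H.
have i1 := area_incr_ge u d0.
have := area_incr_ge (c - (u + d)) d0.
have -> : c - (u + d) + d = c - u by ring.
move=> i2.
have sub : hit c <= hit (u + d) + hit (c - (u + d)).
  rewrite -[X in hit X <= _](subrKC (u + d) c).
  by apply: hit_subadd; rewrite subr_ge0.
have := ler_wpM2l d0 sub.
by move: (hit _) (hit _) (hit _) (hit _) (area _) (area _) (area _) (area _) (area _) i1 i2 => *; lra.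
Qed.

(** Integrates [hit_le_sup]. The mesh error is [d ^+ 2] per cell, hence the identity as comparison
    function in [grid_le0]. *)
Lemma area_le c : 0 <= c -> 2 * mu * area c <= c ^+ 2 + 2 * B * c.
Proof.
move=> c0.
pose H u := 2 * mu * area u - u ^+ 2 - 2 * B * u.
suff : H c <= 0 by rewrite /H; lra.
apply: (@grid_le0 _ c _ (fun u => u)) => //.
  by rewrite /H (area_le0 (lexx 0)) mulr0 expr0n mulr0 !subr0.
move=> u d u0 d0 udc; rewrite /H.
have i1 := area_incr_le u d0.
have i2 := hit_le_sup (addr_ge0 u0 d0).
have m2 : 0 <= 2 * mu by rewrite mulr_ge0// ltW.
have d2 : 0 <= 2 * d by rewrite mulr_ge0.
have := ler_wpM2l m2 i1; have := ler_wpM2l d2 i2.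
move: (hit (u + d)) (area (u + d)) (area u) => x y w; lra.
Qed.

(** By Wald's identity [mu * hit u - u] is the mean overshoot: harmonic for the walk, and
    nonnegative once it has stopped. *)
Lemma hit_ge_mean u : u <= mu * hit u.
Proof.
rewrite -subr_ge0; have B0 := ess_sup_gt0.
apply: (@min_principle (fun u => mu * hit u - u) B (ltW B0)) => c c0.
- by rewrite hit_le0// mulr0 sub0r oppr_ge0.
- have := hit_ge_sup c; have := mulr_ge0 (ltW mu_gt0) (hit_ge0 c); lra.
- by rewrite expectB expectZ expectB (expect_cst p_distr) hitE//; lra.
Qed.

(* The overshoot [r = mu * hit u - u] satisfies [r ^+ 2 <= v * hit u - int_0^u 2 r]:
   the right-hand side dominates the second moment of the overshoot. *)
Lemma overshoot_sqr_le u :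
  (mu * hit u - u) ^+ 2 <= v * hit u - 2 * mu * area u + u ^+ 2.
Proof.
have B0 := ess_sup_gt0.
have v0 : 0 <= v by apply: (expect_ge0 p_distr) => t _; exact: sqr_ge0.
rewrite -subr_ge0.
(* The constant collects two losses: [area_le] costs [2 * B * c] with [c <= B * hit c], and the
   squared mean overshoot is at most [B ^+ 2 <= B ^+ 2 * hit c]. *)
apply: (@min_principle (fun u => v * hit u - 2 * mu * area u + u ^+ 2 -
  (mu * hit u - u) ^+ 2) (2 * B * B + B ^+ 2)) => [|c c0|c c0|c c0].
- by rewrite addr_ge0 ?mulr_ge0 ?sqr_ge0// ltW.
- by rewrite hit_le0// area_le0// !mulr0 subr0 add0r sub0r sqrrN subrr.
- have a1 := area_le (ltW c0).
  have r0 := hit_ge_mean c; have r1 := hit_le_sup (ltW c0).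
  have h1 := hit_ge1 c0; have h2 := hit_ge_sup c.
  have vh := mulr_ge0 v0 (hit_ge0 c).
  have r2 : (mu * hit c - c) ^+ 2 <= B ^+ 2.
    by rewrite lerXn2r ?nnegrE ?(ltW B0)//; lra.
  have B2 : B ^+ 2 <= B ^+ 2 * hit c by rewrite ler_peMr ?sqr_ge0.
  have Bh : B * c <= B * (B * hit c) by rewrite ler_pM2l.
  move: (_ ^+ 2) (hit c) (area c) r2 B2 Bh a1 vh => x h a; lra.
(* The mean overshoot is harmonic, so by Jensen its square can only grow in the mean. *)
- set r := fun u => mu * hit u - u.
  have rE : E (fun t => r (c - z t)) = r c.
    by rewrite /r expectB expectZ expectB (expect_cst p_distr) hitE//; ring.
  have := expect_sqr_le p_distr (fun t => r (c - z t)); rewrite rE => r2.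
  (* Only positive steps enter [v]. A step [z t <= 0] is paid for by the area: [2 * mu * area y >=
     mu * y * hit y >= y ^+ 2] at [y = - z t]. *)
  have neg : 0 <= E (fun t => (Num.max (z t) 0) ^+ 2 - z t ^+ 2 + 2 * mu * area (- z t)).
    apply: (expect_ge0 p_distr) => t _.
    have [zt|zt] := leP (z t) 0; last first.
      by rewrite subrr add0r area_le0 ?mulr0// oppr_le0 ltW.
    have nz : 0 <= - z t by rewrite oppr_ge0.
    have h := area_ge nz; have h1 := hit_ge_mean (- z t).
    have := ler_wpM2l (ltW mu_gt0) h; have := ler_wpM2l nz h1.
    rewrite expr0n /=; move: (area _) (hit _) => a b; lra.
  have hE := hitE c0; have aE := areaE c0.
  rewrite expectB; apply: lerB => //.
  move: neg; rewrite expectD expectB expectZ.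
  rewrite -[E (fun t => Num.max (z t) 0 ^+ 2)]/v.
  have -> : E (fun t => v * hit (c - z t) - 2 * mu * area (c - z t) + (c - z t) ^+ 2) =
    v * E (fun t => hit (c - z t)) - 2 * mu * E (fun t => area (c - z t)) +
    (c ^+ 2 - (2 * c * mu - E (fun t => z t ^+ 2))).
    rewrite expectD expectB !expectZ; congr (_ + _).
    rewrite -(expectZ p (2 * c)) -expectB -[X in X - _](expect_cst p_distr) -expectB.
    by apply: eq_expect => t; ring.
  rewrite hE aE expectB; lra.
Qed.

(** With [r] the mean overshoot, [overshoot_sqr_le] and [area_ge] give [r * (r + u) <= v * hit u];
    since [r + u = mu * hit u], division yields [r <= v / mu]. *)
Lemma hit_le_lorden u : 0 < u -> mu * hit u <= u + v / mu.
Proof.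
move=> u0; have h1 := hit_ge1 u0.
have h2 := overshoot_sqr_le u; have h3 := area_ge (ltW u0).
set r := mu * hit u - u in h2 *.
have hu : mu * hit u = u + r by rewrite /r; ring.
have : r * (mu * hit u) <= v / mu * (mu * hit u).
  have -> : v / mu * (mu * hit u) = v * hit u by rewrite mulrA divfK ?gt_eqF.
  rewrite hu; have := ler_wpM2l (ltW mu_gt0) h3.
  rewrite [mu * (u * _)]mulrCA hu; lra.
rewrite ler_pM2r; first by rewrite hu lerD2l.
by rewrite mulr_gt0// (lt_le_trans ltr01).
Qed.

(** Each term of the minimum in [bfun] bounds the mean overshoot: one by Lorden's inequality, the
    other by the largest step. *)
Lemma hit_le_bfun u : 0 < u -> hit u <= (u + bfun p z) / mu.
Proof.
move=> u0; rewrite ler_pdivlMr// mulrC /bfun -lerBlDl le_min !lerBlDl.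
by rewrite hit_le_lorden// hit_le_sup// ltW.
Qed.

Lemma bfun_ge0 : 0 <= bfun p z.
Proof.
rewrite /bfun le_min (ltW ess_sup_gt0) andbT divr_ge0 ?(ltW mu_gt0)//.
by apply: (expect_ge0 p_distr) => t _; exact: sqr_ge0.
Qed.

End HittingTime.

(** * Codes from random machines *)

Lemma expect_exchange (R : realType) (S T : finType) (p : S -> R) (q : T -> R)
    (F : S -> T -> R) :
  expect p (fun s => expect q (F s)) = expect q (fun t => expect p (F^~ t)).
Proof.
rewrite /expect; under eq_bigr do rewrite mulr_sumr.
rewrite exchange_big; apply: eq_bigr => t _; rewrite mulr_sumr.
by apply: eq_bigr => s _; rewrite mulrCA.
Qed.

Lemma sum_tupleS (V : nmodType) (T : finType) n (F : n.+1.-tuple T -> V) :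
  \sum_t F t = \sum_x \sum_(t : n.-tuple T) F [tuple of x :: t].
Proof.
rewrite pair_bigA /=.
rewrite (reindex (fun xt : T * n.-tuple T => [tuple of xt.1 :: xt.2])) //=.
exists (fun t => (thead t, [tuple of behead t])) => [[x t] _|t _] /=.
  by congr pair; apply: val_inj.
by rewrite [t in RHS]tuple_eta.
Qed.

Lemma sum_tuple0 (V : nmodType) (T : finType) (F : 0.-tuple T -> V) :
  \sum_t F t = F [tuple].
Proof. by rewrite (big_pred1 [tuple]) // => t; apply/esym/eqP/tuple0. Qed.

Lemma forall_ord_recl n (P : pred 'I_n.+1) :
  [forall i, P i] = P ord0 && [forall i, P (lift ord0 i)].
Proof.
apply/forallP/andP => [h|[h0 /forallP h] i]; first by split; [|apply/forallP].
by case: (unliftP ord0 i) => [j|] ->.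
Qed.

Section SequenceLaw.
Variables (R : realType) (T : finType) (p : T -> R).
Hypothesis p_distr : is_distr p.

Definition seq_law n (t : n.-tuple T) : R := \prod_(x <- t) p x.

Lemma expect_seq_law0 (F : 0.-tuple T -> R) : expect (@seq_law 0) F = F [tuple].
Proof. by rewrite /expect sum_tuple0 /seq_law big_nil mul1r. Qed.

Lemma expect_seq_lawS n (F : n.+1.-tuple T -> R) :
  expect (@seq_law n.+1) F =
  expect p (fun x => expect (@seq_law n) (fun t => F [tuple of x :: t])).
Proof.
rewrite /expect sum_tupleS; apply: eq_bigr => x _; rewrite mulr_sumr.
by apply: eq_bigr => t _; rewrite /seq_law big_cons mulrA.
Qed.

Lemma seq_law_distr n : is_distr (@seq_law n).
Proof.
split=> [t|]; first by apply: prodr_ge0 => x _; exact: p_distr.1.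
have -> : \sum_(t : n.-tuple T) seq_law t = expect (@seq_law n) (fun=> 1).
  by rewrite /expect; apply: eq_bigr => t _; rewrite mulr1.
elim: n => [|n IH]; first by rewrite expect_seq_law0.
by rewrite expect_seq_lawS IH (expect_cst p_distr).
Qed.

End SequenceLaw.

(** * First-step decomposition of a run with feedback *)

Section FeedbackRun.
Variables (R : realType) (X Y : finType) (W : X -> Y -> R).
Hypothesis W_channel : is_channel W.
Implicit Types (enc : seq Y -> X) (stp bad : seq Y -> bool).

Lemma channel_distr x : is_distr (W x).
Proof. by split; [exact: W_channel.1|exact: W_channel.2]. Qed.

Definition prob_run enc t (y : t.-tuple Y) : R :=
  \prod_(i < t) W (enc (take i y)) (tnth y i).

(** This and [prob_bad_stop] are the inner sums of [prob_tau_gt] and [prob_err_at] for fixed common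
    randomness and message, without their prior probability. *)
Definition prob_continue enc stp t : R :=
  \sum_(y : t.-tuple Y)
     (if [forall i : 'I_t.+1, ~~ stp (take i y)] then prob_run enc y else 0).

Definition prob_bad_stop enc stp bad t : R :=
  \sum_(y : t.-tuple Y)
     (if (stp y && [forall i : 'I_t, ~~ stp (take i y)]) && bad y
      then prob_run enc y else 0).

Lemma prob_run_cons enc t y0 (y : t.-tuple Y) :
  prob_run enc [tuple of y0 :: y] =
  W (enc [::]) y0 * prob_run (fun ys => enc (y0 :: ys)) y.
Proof.
rewrite /prob_run big_ord_recl /= tnth0; congr (_ * _).
by apply: eq_bigr => i _; rewrite tnthS.
Qed.

Lemma prob_continue0 enc stp : prob_continue enc stp 0 = (~~ stp [::])%:R.
Proof.
rewrite /prob_continue sum_tuple0 /prob_run big_ord0.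
have -> : [forall i : 'I_1, ~~ stp (take i [tuple])] = ~~ stp [::].
  by apply/forallP/idP => [/(_ ord0)|? i].
by case: (stp _).
Qed.

(** Conditioning on the first output leaves a run of the same kind, with encoder and stopping rule
    shifted by it. *)
Lemma prob_continueS enc stp t : prob_continue enc stp t.+1 =
  if stp [::] then 0 else expect (W (enc [::])) (fun y0 =>
    prob_continue (fun ys => enc (y0 :: ys)) (fun ys => stp (y0 :: ys)) t).
Proof.
rewrite /prob_continue sum_tupleS; case: ifP => stp0.
  by rewrite big1// => y0 _; rewrite big1// => y _; rewrite forall_ord_recl /= stp0.
rewrite /expect; apply: eq_bigr => y0 _; rewrite mulr_sumr; apply: eq_bigr => y _.
rewrite forall_ord_recl /= stp0 /=; case: ifP => _; last by rewrite mulr0.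
exact: prob_run_cons.
Qed.

Lemma prob_bad_stop0 enc stp bad :
  prob_bad_stop enc stp bad 0 = (stp [::] && bad [::])%:R.
Proof.
rewrite /prob_bad_stop sum_tuple0 /prob_run big_ord0.
have -> : [forall i : 'I_0, ~~ stp (take i [tuple])] by apply/forallP => -[].
by rewrite andbT; case: (_ && _).
Qed.

Lemma prob_bad_stopS enc stp bad t : prob_bad_stop enc stp bad t.+1 =
  if stp [::] then 0 else expect (W (enc [::])) (fun y0 =>
    prob_bad_stop (fun ys => enc (y0 :: ys)) (fun ys => stp (y0 :: ys))
      (fun ys => bad (y0 :: ys)) t).
Proof.
rewrite /prob_bad_stop sum_tupleS; case: ifP => stp0.
  rewrite big1// => y0 _; rewrite big1// => y _.
  by rewrite forall_ord_recl /= stp0 /= andbF.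
rewrite /expect; apply: eq_bigr => y0 _; rewrite mulr_sumr; apply: eq_bigr => y _.
rewrite forall_ord_recl /= stp0 /=; case: ifP => _; last by rewrite mulr0.
exact: prob_run_cons.
Qed.

Lemma sum_prob_continue_stopped enc stp T : stp [::] ->
  \sum_(t < T) prob_continue enc stp t = 0.
Proof.
by move=> s0; rewrite big1// => -[[|t] _] _ /=; rewrite ?prob_continue0 ?prob_continueS s0.
Qed.

Lemma sum_prob_bad_stop_stopped enc stp bad T : stp [::] ->
  \sum_(t < T) prob_bad_stop enc stp bad t <= (bad [::])%:R.
Proof.
move=> s0; case: T => [|T]; first by rewrite big_ord0 ler0n.
rewrite big_ord_recl prob_bad_stop0 s0 /= big1 ?addr0// => i _.
by rewrite prob_bad_stopS s0.
Qed.

Lemma sum_prob_continueS enc stp T : ~~ stp [::] ->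
  \sum_(t < T.+1) prob_continue enc stp t =
  1 + expect (W (enc [::])) (fun y0 => \sum_(t < T)
    prob_continue (fun ys => enc (y0 :: ys)) (fun ys => stp (y0 :: ys)) t).
Proof.
move=> s0; rewrite big_ord_recl prob_continue0 s0 expect_sum; congr (_ + _).
by apply: eq_bigr => t _; rewrite prob_continueS (negbTE s0).
Qed.

Lemma sum_prob_bad_stopS enc stp bad T : ~~ stp [::] ->
  \sum_(t < T.+1) prob_bad_stop enc stp bad t =
  expect (W (enc [::])) (fun y0 => \sum_(t < T)
    prob_bad_stop (fun ys => enc (y0 :: ys)) (fun ys => stp (y0 :: ys))
      (fun ys => bad (y0 :: ys)) t).
Proof.
move=> s0; rewrite big_ord_recl prob_bad_stop0 (negbTE s0) add0r expect_sum.
by apply: eq_bigr => t _; rewrite prob_bad_stopS (negbTE s0).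
Qed.

End FeedbackRun.

(** * Finite random codes from a machine with potential functions *)

Section MachineCode.
Variables (R : realType) (X Y V : finType) (W : X -> Y -> R) (M : nat) (St : Type).
Variables (q : V -> R) (v0 : V).
Variables (inp : St -> 'I_M -> V -> X) (step : St -> V -> Y -> St).
Variables (halt : St -> bool) (dec : St -> 'I_M) (ok : St -> Prop).
Variables (time err : 'I_M -> St -> R).
Hypothesis W_channel : is_channel W.
Hypothesis q_distr : is_distr q.
Let next w s (f : St -> R) :=
  expect q (fun v => expect (W (inp s w v)) (fun y => f (step s v y))).
Hypothesis ok_step : forall s v y, ok s -> ~~ halt s -> ok (step s v y).
Hypothesis time_ge0 : forall w s, 0 <= time w s.
Hypothesis err_ge0 : forall w s, 0 <= err w s.
Hypothesis time_step :
  forall w s, ok s -> ~~ halt s -> 1 + next w s (time w) <= time w s.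
Hypothesis err_step :
  forall w s, ok s -> ~~ halt s -> next w s (err w) <= err w s.
Hypothesis err_halt :
  forall w s, ok s -> halt s -> (dec s != w)%:R <= err w s.

(** The codebook [cs] holds one column per channel use. Running out of columns forces a stop, so the
    default [v0] is read only after stopping. *)
Let state s (cs : seq V) (ys : seq Y) : St :=
  foldl (fun s vy => step s vy.1 vy.2) s (zip cs ys).
Let enc s cs w ys := inp (state s cs ys) w (nth v0 cs (size ys)).
Let stp s cs ys := (size cs <= size ys)%N || halt (state s cs ys).
Let bad s cs w ys := dec (state s cs ys) != w.

Lemma state_nil s cs : state s cs [::] = s.
Proof. by rewrite /state; case: cs. Qed.

(** Each channel use costs one unit of the potential [time]; exhausting the codebook only shortens
    the run. *)
Lemma time_bound w n s T : ok s ->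
  expect (@seq_law _ _ q n) (fun cs =>
    \sum_(t < T) prob_continue W (enc s cs w) (stp s cs) t) <= time w s.
Proof.
elim: n s T => [|n IH] s T oks.
  by rewrite expect_seq_law0 sum_prob_continue_stopped.
have [hs|hs] := boolP (halt s).
  rewrite (@eq_expect _ _ _ _ (fun=> 0)) => [|cs].
    by rewrite (expect_cst (seq_law_distr q_distr _)).
  by rewrite sum_prob_continue_stopped// /stp state_nil hs orbT.
case: T => [|T].
  rewrite (@eq_expect _ _ _ _ (fun=> 0)) => [|cs]; last by rewrite big_ord0.
  by rewrite (expect_cst (seq_law_distr q_distr _)).
rewrite expect_seq_lawS; apply: le_trans (time_step w oks hs).
rewrite -(expect_cst q_distr 1) /next -expectD.
apply: (le_expect q_distr) => v _.
rewrite (@eq_expect _ _ _ _ (fun cs : n.-tuple V =>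
  1 + expect (W (inp s w v)) (fun y => \sum_(t < T)
    prob_continue W (enc (step s v y) cs w) (stp (step s v y) cs) t))); last first.
  by move=> cs; rewrite sum_prob_continueS.
(* The remaining columns are independent of the current output, so the two averages commute. *)
rewrite expectD (expect_cst (seq_law_distr q_distr _)) lerD2l expect_exchange.
by apply: (le_expect (channel_distr W_channel _)) => y _; apply: IH; exact: ok_step.
Qed.

(* Markov's inequality for the truncation at time [N], in potential form: after
   [N - n] steps the conditional expectation of the total time is at most
   [time w s + (N - n)]. *)
Lemma error_bound w N n s T : (0 < N)%N -> (n <= N)%N -> ok s ->
  expect (@seq_law _ _ q n) (fun cs =>
    \sum_(t < T) prob_bad_stop W (enc s cs w) (stp s cs) (bad s cs w) t)
  <= err w s + (time w s + N%:R - n%:R) / N%:R.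
Proof.
move=> N0; elim: n s T => [|n IH] s T nN oks.
  (* With no column left the Markov term is at least 1 and pays for any decision. *)
  rewrite expect_seq_law0; apply: le_trans (sum_prob_bad_stop_stopped _ _ _ _ _) _ => //.
  apply: le_trans (_ : 1 <= _); first by rewrite lern1 leq_b1.
  rewrite -[leLHS]add0r lerD// subr0 mulrDl divff ?pnatr_eq0 -?lt0n//.
  by rewrite lerDr divr_ge0.
have rest0 : 0 <= (time w s + N%:R - n.+1%:R) / N%:R.
  by rewrite divr_ge0// -addrA addr_ge0// subr_ge0 ler_nat.
have [hs|hs] := boolP (halt s).
  rewrite -[leLHS]addr0 lerD//; apply: le_trans (err_halt w oks hs).
  rewrite -(expect_cst (seq_law_distr q_distr n.+1) (dec s != w)%:R).
  apply: (le_expect (seq_law_distr q_distr _)) => cs _.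
  apply: le_trans (sum_prob_bad_stop_stopped _ _ _ _ _) _; first by rewrite /stp state_nil hs orbT.
  by rewrite /bad state_nil.
case: T => [|T].
  rewrite (@eq_expect _ _ _ _ (fun=> 0)) => [|cs]; last by rewrite big_ord0.
  by rewrite (expect_cst (seq_law_distr q_distr _)) addr_ge0.
rewrite expect_seq_lawS.
apply: le_trans (_ : next w s (fun s' => err w s' + (time w s' + N%:R - n%:R) / N%:R) <= _).
  rewrite /next; apply: (le_expect q_distr) => v _.
  rewrite (@eq_expect _ _ _ _ (fun cs : n.-tuple V =>
    expect (W (inp s w v)) (fun y => \sum_(t < T)
      prob_bad_stop W (enc (step s v y) cs w) (stp (step s v y) cs)
        (bad (step s v y) cs w) t))); last first.
    by move=> cs; rewrite sum_prob_bad_stopS.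
  rewrite expect_exchange.
  apply: (le_expect (channel_distr W_channel _)) => y _.
  by apply: IH; [exact: ltnW|exact: ok_step].
(* Using up one column adds one to the numerator, which is the unit supplied by [time_step]. *)
have -> : next w s (fun s' => err w s' + (time w s' + N%:R - n%:R) / N%:R) =
  next w s (err w) + (1 + next w s (time w) + N%:R - n.+1%:R) / N%:R.
  rewrite /next -natr1.
  transitivity (expect q (fun v => expect (W (inp s w v)) (fun y => err w (step s v y))
     + ((N%:R)^-1 * expect (W (inp s w v)) (fun y => time w (step s v y))
     + (N%:R - n%:R) / N%:R))).
    apply: eq_expect => v.
    rewrite -expectZ -[(N%:R - n%:R) / _](expect_cst (channel_distr W_channel (inp s w v))).
    by rewrite -!expectD; apply: eq_expect => y; ring.
  by rewrite !expectD expectZ (expect_cst q_distr); ring.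
rewrite lerD ?err_step// ler_wpM2r ?invr_ge0//.
by rewrite !lerD2r time_step.
Qed.

(* With probability [c] the code stops at time [0] and decodes [m0]. *)
Lemma machine_code (c time0 err0 : R) (N : nat) (m0 : 'I_M) (s0 : St) :
  0 <= c <= 1 -> (0 < N)%N -> ok s0 ->
  (forall w, time w s0 <= time0) -> (forall w, err w s0 <= err0) ->
  exists (k : nat) (PU : 'I_k -> R) (enc' : 'I_k -> 'I_M -> seq Y -> X)
    (stp' : 'I_k -> seq Y -> bool) (dec' : 'I_k -> seq Y -> 'I_M),
    is_VLF_code W PU enc' stp' dec' ((1 - c) * time0)
      (c * (1 - M%:R^-1) + (1 - c) * (err0 + time0 / N%:R)).
Proof.
move=> /andP[c0 c1] N0 ok0 time_s0 err_s0.
have c1' : 0 <= 1 - c by rewrite subr_ge0.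
have M0 : M%:R != 0 :> R by rewrite pnatr_eq0 -lt0n; case: (m0) => m; case: (M).
(* Index 0 of the common randomness is the blind guess; the others enumerate the codebooks of length
   [N]. *)
pose cb (i : 'I_#|{: N.-tuple V}|.+1) : option (N.-tuple V) :=
  omap enum_val (unlift ord0 i).
have sum_cb (H : option (N.-tuple V) -> R) :
    \sum_i H (cb i) = H None + \sum_cs H (Some cs).
  rewrite big_ord_recl /cb unlift_none; congr (_ + _).
  rewrite [RHS]big_enum_val; apply: eq_bigr => i _.
  by rewrite liftK.
pose P (u : option (N.-tuple V)) : R :=
  if u is Some cs then (1 - c) * seq_law q cs else c.
pose encu (u : option (N.-tuple V)) w ys :=
  if u is Some cs then enc s0 cs w ys else inp s0 w v0.
pose stpu (u : option (N.-tuple V)) ys :=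
  if u is Some cs then stp s0 cs ys else true.
pose decu (u : option (N.-tuple V)) ys :=
  if u is Some cs then dec (state s0 cs ys) else m0.
(* Shared by time and error: [a] bounds the blind guess message by message, [b] the codebook average
   uniformly in the message. *)
have average (F : option (N.-tuple V) -> 'I_M -> nat -> R) T (a : 'I_M -> R) (b : R) :
    (forall w, \sum_(t < T) F None w t <= a w) ->
    (forall w, expect (@seq_law _ _ q N) (fun cs => \sum_(t < T) F (Some cs) w t) <= b) ->
    \sum_(t < T) \sum_i \sum_w P (cb i) / M%:R * F (cb i) w t <=
      c * (M%:R^-1 * \sum_w a w) + (1 - c) * b.
  move=> Fa Fb.
  have -> : \sum_(t < T) \sum_i \sum_w P (cb i) / M%:R * F (cb i) w t =
    \sum_w M%:R^-1 * (c * \sum_(t < T) F None w t +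
      (1 - c) * expect (@seq_law _ _ q N) (fun cs => \sum_(t < T) F (Some cs) w t)).
    rewrite exchange_big /=; under eq_bigr => i _ do rewrite exchange_big /=.
    rewrite exchange_big /=; apply: eq_bigr => w _.
    rewrite (sum_cb (fun u => \sum_(t < T) P u / M%:R * F u w t)) mulrDr.
    congr (_ + _).
      by rewrite /P -mulr_sumr mulrA [c / _]mulrC.
    rewrite /expect !mulr_sumr; apply: eq_bigr => cs _.
    by rewrite -mulr_sumr /P; ring.
  rewrite -mulr_sumr big_split /= -mulr_sumr mulrDr mulrCA lerD//.
    by rewrite ler_wpM2l// ler_wpM2l ?invr_ge0// ler_sum.
  rewrite -mulr_sumr mulrCA ler_wpM2l//.
  rewrite -[leRHS](mulKf M0) ler_wpM2l ?invr_ge0//.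
  rewrite mulr_natl -[X in _ <= b *+ X](card_ord M) -sumr_const.
  by apply: ler_sum.
exists _, (fun i => P (cb i)), (fun i => encu (cb i)), (fun i => stpu (cb i)),
  (fun i => decu (cb i)).
split; [split|split => T].
- move=> i; rewrite /P; case: (cb i) => // cs.
  by rewrite mulr_ge0// (seq_law_distr q_distr N).1.
- rewrite (sum_cb P) /P -mulr_sumr (seq_law_distr q_distr N).2 mulr1.
  by rewrite addrC subrK.
- have -> : \sum_(t < T) prob_tau_gt W (fun i => P (cb i)) (fun i => encu (cb i))
        (fun i => stpu (cb i)) t =
      \sum_(t < T) \sum_i \sum_w P (cb i) / M%:R *
        prob_continue W (encu (cb i) w) (stpu (cb i)) t.
    apply: eq_bigr => t _; apply: eq_bigr => i _; apply: eq_bigr => w _.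
    rewrite /prob_continue mulr_sumr; apply: eq_bigr => y _.
    by rewrite /not_stopped; case: ifP => // _; rewrite mulr0.
  have := @average (fun u w t => prob_continue W (encu u w) (stpu u) t) T
    (fun=> 0) time0.
  rewrite (_ : \sum_(w < M) 0 = 0 :> R); last by rewrite big1.
  rewrite !mulr0 add0r; apply => w.
    by rewrite sum_prob_continue_stopped.
  by apply: le_trans (time_s0 w); exact: time_bound.
- have -> : \sum_(t < T) prob_err_at W (fun i => P (cb i)) (fun i => encu (cb i))
        (fun i => stpu (cb i)) (fun i => decu (cb i)) t =
      \sum_(t < T) \sum_i \sum_w P (cb i) / M%:R *
        prob_bad_stop W (encu (cb i) w) (stpu (cb i))
          (fun ys => decu (cb i) ys != w) t.
    apply: eq_bigr => t _; apply: eq_bigr => i _; apply: eq_bigr => w _.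
    rewrite /prob_bad_stop mulr_sumr; apply: eq_bigr => y _.
    by rewrite /stops_at; case: ifP => // _; rewrite mulr0.
  have -> : 1 - M%:R^-1 = M%:R^-1 * \sum_w (m0 != w)%:R :> R.
    rewrite (bigD1 m0) //= eqxx add0r.
    rewrite (eq_bigr (fun=> 1)) => [|w]; last by rewrite eq_sym => ->.
    rewrite sumr_const cardC1 card_ord -subn1 natrB; last by case: (m0) => m; case: (M).
    by rewrite mulrBr mulVf// mulr1.
  apply: (@average (fun u w t => prob_bad_stop W (encu u w) (stpu u)
    (fun ys => decu u ys != w) t) T) => w.
    by rewrite sum_prob_bad_stop_stopped.
  apply: le_trans (error_bound w T N0 (leqnn N) ok0) _.
  by rewrite lerD// ler_wpM2r ?invr_ge0// addrK.
Qed.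

End MachineCode.

(** * Likelihood ratios *)

(** Zero arguments are covered because division by 0 and the logarithm of 0 both give 0. *)
Lemma ln_divC (R : realType) (a b : R) :
  0 <= a -> 0 <= b -> ln (a / b) = - ln (b / a).
Proof.
rewrite !le_eqVlt => /predU1P[<-|a0] /predU1P[<-|b0].
- by rewrite mul0r ln0// oppr0.
- by rewrite mul0r invr0 mulr0 ln0// oppr0.
- by rewrite mul0r invr0 mulr0 ln0// oppr0.
- by rewrite -invf_div lnV// posrE divr_gt0.
Qed.

(** * Random codebook columns: independent letters, one per message *)

Section IidColumn.
Variables (R : realType) (X : finType) (P : X -> R) (M : nat).
Hypothesis P_distr : is_distr P.

Definition column_law (v : {ffun 'I_M -> X}) : R := \prod_m P (v m).

Lemma expect_column_prod (h : 'I_M -> X -> R) :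
  expect column_law (fun v => \prod_m h m (v m)) = \prod_m expect P (h m).
Proof.
rewrite /expect bigA_distr_bigA; apply: eq_bigr => v _.
by rewrite /column_law -big_split.
Qed.

Lemma column_law_distr : is_distr column_law.
Proof.
split=> [v|]; first by apply: prodr_ge0 => m _; exact: P_distr.1.
have -> : \sum_v column_law v = expect column_law (fun v => \prod_(m < M) 1).
  by rewrite /expect; apply: eq_bigr => v _; rewrite big1 ?mulr1.
rewrite (expect_column_prod (fun _ _ => 1)) big1// => m _.
exact: expect_cst.
Qed.

Lemma expect_column1 w (f : X -> R) :
  expect column_law (fun v => f (v w)) = expect P f.
Proof.
pose h m := if m == w then f else fun=> 1.
have := expect_column_prod h.
rewrite [in X in _ = X](bigD1 w) //= [in X in _ = _ * X]big1 => [|m /negbTE mw]; last first.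
  by rewrite /h mw (expect_cst P_distr).
rewrite mulr1 /h eqxx => <-; apply: eq_expect => v.
by rewrite (bigD1 w) //= eqxx big1 ?mulr1// => m /negbTE->.
Qed.

Lemma expect_column2 w m (f g : X -> R) : m != w ->
  expect column_law (fun v => f (v w) * g (v m)) = expect P f * expect P g.
Proof.
move=> mw; pose h i := if i == w then f else if i == m then g else fun=> 1.
have := expect_column_prod h.
rewrite [in X in _ = X](bigD1 w) //= [in X in _ = _ * X](bigD1 m) //=.
rewrite [in X in _ = _ * (_ * X)]big1 => [|i /andP[/negbTE iw /negbTE im]]; last first.
  by rewrite /h iw im (expect_cst P_distr).
rewrite mulr1 /h eqxx (negbTE mw) eqxx => <-; apply: eq_expect => v.
rewrite (bigD1 w) //= eqxx (bigD1 m) //= (negbTE mw) eqxx big1 ?mulr1//.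
by move=> i /andP[/negbTE-> /negbTE->].
Qed.

End IidColumn.

(** * Divergence and information density *)

Section Divergence.
Variables (R : realType) (X Y : finType) (W : X -> Y -> R).
Hypothesis W_channel : is_channel W.
Hypothesis W_ac : forall x x' y, 0 < W x y -> 0 < W x' y.

(** By absolute continuity [W x'] has no mass outside the support of [W x], so nothing is lost in
    the weighted sum. *)
Lemma expect_likelihood_ratio x x' :
  expect (W x) (fun y => expR (ln (W x' y / W x y))) = 1.
Proof.
rewrite -(W_channel.2 x') /expect; apply: eq_bigr => y _.
have := W_channel.1 x y; rewrite le_eqVlt => /predU1P[x0|x0].
  rewrite -x0 mul0r; have := W_channel.1 x' y.
  by rewrite le_eqVlt => /predU1P[//|/(W_ac x)]; rewrite -x0 ltxx.
by rewrite lnK ?posrE ?divr_gt0// ?(W_ac _ x0)// mulrC divfK// gt_eqF.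
Qed.

(** Equality case of Gibbs' inequality: as the likelihood ratio has mean 1, the divergence is the
    sum of the nonnegative [g y]. A vanishing term forces its log-ratio or its weight to be 0. *)
Lemma KLdiv_le0_eq x x' : KLdiv W x x' <= 0 -> W x =1 W x'.
Proof.
pose g y := W x y * (expR (ln (W x' y / W x y)) - 1 - ln (W x' y / W x y)).
have g0 y : 0 <= g y.
  rewrite mulr_ge0 ?W_channel.1//.
  by have := expR_ge1Dx (ln (W x' y / W x y)); lra.
have sg : \sum_y g y = KLdiv W x x'.
  have -> : \sum_y g y = expect (W x) (fun y => expR (ln (W x' y / W x y)) - 1 -
      ln (W x' y / W x y)) by [].
  rewrite !expectB expect_likelihood_ratio (expect_cst (channel_distr W_channel x)).
  rewrite subrr sub0r /expect -sumrN; apply: eq_bigr => y _.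
  by rewrite [in RHS]ln_divC ?W_channel.1// mulrN.
rewrite -sg => sg0 y.
have /eqP : \sum_y g y = 0 by apply/le_anti; rewrite sg0 sumr_ge0.
rewrite psumr_eq0 => [/allP/(_ y)|? _]; last exact: g0.
rewrite mem_index_enum => /(_ isT) /=; rewrite /g mulf_eq0 => /orP[/eqP x0|].
  rewrite x0; have := W_channel.1 x' y.
  by rewrite le_eqVlt => /predU1P[//|/(W_ac x)]; rewrite x0 ltxx.
have [ln0|/expR_gt1Dx] := eqVneq (ln (W x' y / W x y)) 0; last by lra.
move=> _; have := W_channel.1 x y; rewrite le_eqVlt => /predU1P[x0|x0].
  have := W_channel.1 x' y; rewrite -x0.
  by rewrite le_eqVlt => /predU1P[//|/(W_ac x)]; rewrite -x0 ltxx.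
have : expR (ln (W x' y / W x y)) = 1 by rewrite ln0 expR0.
rewrite lnK ?posrE ?divr_gt0 ?(W_ac _ x0)// => /(congr1 ( *%R^~ (W x y))).
by rewrite mul1r divfK ?gt_eqF.
Qed.

Variables (PX : X -> R).
Hypothesis PX_distr : is_distr PX.

Definition joint_law (xy : X * Y) : R := PX xy.1 * W xy.1 xy.2.

Lemma expect_joint_law (F : X * Y -> R) :
  expect joint_law F = expect PX (fun x => expect (W x) (fun y => F (x, y))).
Proof.
rewrite /expect; transitivity (\sum_x \sum_y joint_law (x, y) * F (x, y)).
  by rewrite pair_bigA; apply: eq_bigr => -[].
apply: eq_bigr => x _; rewrite mulr_sumr.
by apply: eq_bigr => y _; rewrite mulrA.
Qed.

Lemma joint_law_distr : is_distr joint_law.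
Proof.
split=> [xy|]; first by rewrite mulr_ge0 ?PX_distr.1 ?W_channel.1.
have -> : \sum_xy joint_law xy = expect joint_law (fun=> 1).
  by rewrite /expect; apply: eq_bigr => xy _; rewrite mulr1.
rewrite expect_joint_law (@eq_expect _ _ PX _ (fun=> 1)) ?(expect_cst PX_distr)// => x.
by rewrite (expect_cst (channel_distr W_channel x)).
Qed.

Lemma mutual_infoE :
  mutual_info PX W = expect joint_law (fun xy => info_dens PX W xy.1 xy.2).
Proof.
rewrite expect_joint_law /expect; apply: eq_bigr => x _; rewrite mulr_sumr.
by apply: eq_bigr => y _; rewrite mulrA.
Qed.

(** If the maximal divergence vanished, all rows would agree and no information would pass. If the
    reverse one vanished, the rows of [xA] and [xR] would agree, annihilating the first. *)
Lemma mutual_info_gt0_KLdiv xA xR :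
  (forall x x', KLdiv W x x' <= KLdiv W xA xR) -> 0 < mutual_info PX W ->
  0 < KLdiv W xA xR /\ 0 < KLdiv W xR xA.
Proof.
move=> KLmax I0.
have KLA : 0 < KLdiv W xA xR.
  rewrite ltNge; apply/negP => KL0; move: I0; apply/negP; rewrite -leNgt.
  have rows x x' : W x =1 W x'.
    by apply: KLdiv_le0_eq; exact: le_trans KL0.
  rewrite /mutual_info big1// => x _; rewrite big1// => y _.
  rewrite /info_dens.
  have -> : out_distr PX W y = W x y.
    rewrite /out_distr (eq_bigr (fun x' => PX x' * W x y)) => [|x' _].
      by rewrite -mulr_suml PX_distr.2 mul1r.
    by rewrite (rows x' x).
  have [->|x0] := eqVneq (W x y) 0; first by rewrite mulr0 mul0r.
  by rewrite divff// ln1 mulr0.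
split=> //; rewrite ltNge; apply/negP => /KLdiv_le0_eq AR.
move: KLA; rewrite /KLdiv big1 ?ltxx// => y _; rewrite AR.
have [->|x0] := eqVneq (W xA y) 0; first by rewrite mul0r.
by rewrite divff// ln1 mulr0.
Qed.

(** A wrong message's letter is independent of the output, so the ratio of [W x y] to the output
    probability averages to 1 over it. *)
Lemma expect_info_dens_indep M (w m : 'I_M) : m != w ->
  expect (column_law PX (M := M)) (fun v =>
    expect (W (v w)) (fun y => expR (info_dens PX W (v m) y))) = 1.
Proof.
move=> mw; rewrite /(expect (W _)) expect_sum.
have PY_sum : \sum_y out_distr PX W y = 1.
  rewrite exchange_big /= -PX_distr.2; apply: eq_bigr => x _.
  by rewrite -mulr_sumr W_channel.2 mulr1.
rewrite -PY_sum; apply: eq_bigr => y _.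
rewrite (expect_column2 PX_distr (W^~ y) (fun x => expR (info_dens PX W x y)) mw).
rewrite -[expect PX (W^~ y)]/(out_distr PX W y).
have PY0 : 0 <= out_distr PX W y.
  by apply: sumr_ge0 => x _; rewrite mulr_ge0 ?PX_distr.1 ?W_channel.1.
move: PY0; rewrite le_eqVlt => /predU1P[<-|PY0]; first by rewrite mul0r.
(* An output of positive probability is reachable from every letter, so [expR] undoes the logarithm
   exactly. *)
have Wy x : 0 < W x y.
  apply: contraTT PY0 => nW; rewrite -leNgt /out_distr big1// => x' _.
  have := W_channel.1 x' y; rewrite le_eqVlt => /predU1P[<-|/(W_ac x) W0].
    by rewrite mulr0.
  by rewrite W0 in nW.
have -> : expect PX (fun x => expR (info_dens PX W x y)) =
  expect PX (fun x => (out_distr PX W y)^-1 * W x y).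
  by apply: eq_expect => x; rewrite /info_dens lnK ?posrE ?divr_gt0// mulrC.
by rewrite expectZ -[expect PX (W^~ y)]/(out_distr PX W y) mulVf ?mulr1// gt_eqF.
Qed.

End Divergence.

(** * The two-phase scheme *)

Section Scheme.
Variables (R : realType) (X Y : finType) (W : X -> Y -> R) (M : nat).
Variables (gamma1 gamma2 aA aR : R) (PX : X -> R) (xA xR : X) (m0 : 'I_M).
Hypothesis W_channel : is_channel W.
Hypothesis W_ac : forall x x' y, 0 < W x y -> 0 < W x' y.
Hypotheses (gamma1_gt0 : 0 < gamma1) (gamma12 : gamma1 < gamma2).
Hypotheses (aA_gt0 : 0 < aA) (aR_gt0 : 0 < aR).
Hypothesis PX_distr : is_distr PX.
Hypothesis C_gt0 : 0 < mutual_info PX W.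
Hypothesis DA_gt0 : 0 < KLdiv W xA xR.
Hypothesis DR_gt0 : 0 < KLdiv W xR xA.

(* [D m] is the accumulated information density of message [m] and [l] the
   log-likelihood ratio of accepting over rejecting the tentative decision. *)
Inductive state :=
| Comm1 (D : 'I_M -> R)
| Confirm (D : 'I_M -> R) (m : 'I_M) (l : R)
| Comm2 (D : 'I_M -> R)
| Accept (m : 'I_M).

Notation column := {ffun 'I_M -> X}.
Implicit Types (D : 'I_M -> R) (v : column) (y : Y) (w m : 'I_M) (l : R).

Definition update D v y m : R := D m + info_dens PX W (v m) y.

Definition enter_confirm D : state :=
  if [pick m | gamma1 <= D m] is Some m then Confirm D m 0 else Comm1 D.

(** The levels [D] stay frozen during confirmation, so a rejection resumes the random code where it
    stopped. *)
Definition after_confirm D m l : state :=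
  if aA <= l then Accept m else if l <= - aR then Comm2 D else Confirm D m l.

Definition llrA y : R := ln (W xA y / W xR y).
Definition llrR y : R := ln (W xR y / W xA y).

Definition scheme_step s v y : state :=
  match s with
  | Comm1 D => enter_confirm (update D v y)
  | Confirm D m l => after_confirm D m (l + llrA y)
  | Comm2 D => Comm2 (update D v y)
  | Accept m => s
  end.

Definition scheme_input s w v : X :=
  if s is Confirm _ m _ then (if m == w then xA else xR) else v w.

Definition scheme_halt s : bool :=
  match s with
  | Comm2 D => [exists m, gamma2 <= D m]
  | Accept _ => true
  | _ => false
  end.

Definition scheme_dec s : 'I_M :=
  match s with
  | Comm2 D => odflt m0 [pick m | gamma2 <= D m]
  | Accept m => m
  | _ => m0
  end.

(** Together with not having halted, this keeps the pending hitting levels positive, as [hitE]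
    requires. *)
Definition scheme_ok s : Prop :=
  match s with
  | Comm1 D => forall m, D m < gamma1
  | Confirm _ _ l => - aR < l < aA
  | _ => True
  end.

Definition hitC : R -> R := hit (joint_law W PX) (fun xy => info_dens PX W xy.1 xy.2).
Definition hitA : R -> R := hit (W xA) llrA.
Definition hitR : R -> R := hit (W xR) llrR.

(** A union bound over wrong messages reaching [g]: each summand is a likelihood-ratio martingale,
    at least 1 once its message crosses. *)
Definition wrong_mass D w (g : R) : R := \sum_(m | m != w) expR (D m - g).

(* On a wrong tentative decision the second communication phase is charged from
   the level of the true message, [hitC (gamma2 - D w)]; subadditivity of [hitC]
   splits this into [hitC (gamma1 - D w)], already paid for, and
   [hitC (gamma2 - gamma1)]. *)
Definition scheme_time w s : R :=
  match s with
  | Comm1 D => hitC (gamma1 - D w)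
      + wrong_mass D w gamma1 * (hitC (gamma2 - gamma1) + hitR aR)
      + expR (- aR) * hitC (gamma2 - gamma1) + hitA aA
  | Confirm D m l =>
      if m == w then hitA (aA - l) + expR (- l - aR) * hitC (gamma2 - D w)
      else hitR (aR + l) + hitC (gamma2 - D w)
  | Comm2 D => hitC (gamma2 - D w)
  | Accept _ => 0
  end.

(** [expR (l - aA)] bounds false acceptance by the test started from [l]. Until acceptance, a wrong
    end of the second phase is charged as [wrong_mass] at [gamma2]. *)
Definition scheme_err w s : R :=
  match s with
  | Comm1 D => wrong_mass D w gamma1 * expR (- aA) + wrong_mass D w gamma2
  | Confirm D m l =>
      (if m == w then 0 else expR (l - aA)) + wrong_mass D w gamma2
  | Comm2 D => wrong_mass D w gamma2
  | Accept m => (m != w)%:R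
  end.

Let WD x : is_distr (W x) := channel_distr W_channel x.
Let QD : is_distr (column_law PX (M := M)) := column_law_distr M PX_distr.
Let JD : is_distr (joint_law W PX) := joint_law_distr W_channel PX_distr.

Let muC_gt0 : 0 < expect (joint_law W PX) (fun xy => info_dens PX W xy.1 xy.2).
Proof. by rewrite -mutual_infoE. Qed.

Lemma llrRE y : llrR y = - llrA y.
Proof. by rewrite /llrR ln_divC ?W_channel.1. Qed.

Lemma hitC_ge0 u : 0 <= hitC u. Proof. exact: hit_ge0. Qed.
Lemma hitA_ge0 u : 0 <= hitA u. Proof. exact: hit_ge0. Qed.
Lemma hitR_ge0 u : 0 <= hitR u. Proof. exact: hit_ge0. Qed.

Lemma le_hitC u c : u <= c -> hitC u <= hitC c.
Proof. exact: le_hit. Qed.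

Lemma wrong_mass_ge0 D w g : 0 <= wrong_mass D w g.
Proof. by apply: sumr_ge0 => m _; exact: expR_ge0. Qed.

Lemma wrong_mass_ge D w g m : m != w -> expR (D m - g) <= wrong_mass D w g.
Proof.
move=> mw; rewrite /wrong_mass (bigD1 m) //= lerDl.
by apply: sumr_ge0 => i _; exact: expR_ge0.
Qed.

Lemma wrong_mass_ge1 D w g m : m != w -> g <= D m -> 1 <= wrong_mass D w g.
Proof.
move=> mw gS; apply: le_trans (wrong_mass_ge D g mw).
by rewrite -expR0 ler_expR subr_ge0.
Qed.

Let next w s (f : state -> R) := expect (column_law PX (M := M)) (fun v =>
  expect (W (scheme_input s w v)) (fun y => f (scheme_step s v y))).

Let comm w (f : column -> Y -> R) :=
  expect (column_law PX (M := M)) (fun v => expect (W (v w)) (f v)).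

Let commD w (f g : column -> Y -> R) :
  comm w (fun v y => f v y + g v y) = comm w f + comm w g.
Proof. by rewrite /comm -expectD; apply: eq_expect => v; rewrite expectD. Qed.

Let commZ w c (f : column -> Y -> R) :
  comm w (fun v y => f v y * c) = comm w f * c.
Proof.
rewrite /comm mulrC -expectZ; apply: eq_expect => v.
by rewrite -expectZ; apply: eq_expect => y; rewrite mulrC.
Qed.

Let comm_cst w c : comm w (fun _ _ => c) = c.
Proof.
rewrite /comm -[RHS](expect_cst QD); apply: eq_expect => v.
exact: expect_cst.
Qed.

Let le_comm w (f g : column -> Y -> R) :
  (forall v y, f v y <= g v y) -> comm w f <= comm w g.
Proof.
move=> fg; apply: (le_expect QD) => v _.
by apply: (le_expect (WD _)) => y _.
Qed.

(** The transmitted letter and its output follow [joint_law], so this is the recursion of [hit]. *)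
Lemma comm_hitC w D g : D w < g ->
  1 + comm w (fun v y => hitC (g - update D v y w)) = hitC (g - D w).
Proof.
move=> Sg; rewrite [in RHS]/hitC (hitE JD muC_gt0) ?subr_gt0// expect_joint_law.
rewrite -(expect_column1 PX_distr w); congr (_ + _).
apply: eq_expect => v; apply: eq_expect => y.
by rewrite /update opprD addrA.
Qed.

Lemma comm_wrong_mass w D g :
  comm w (fun v y => wrong_mass (update D v y) w g) = wrong_mass D w g.
Proof.
transitivity (expect (column_law PX (M := M)) (fun v => \sum_(m | m != w)
    expR (D m - g) * expect (W (v w)) (fun y => expR (info_dens PX W (v m) y)))).
  apply: eq_expect => v; rewrite expect_sum; apply: eq_bigr => m mw.
  by rewrite -expectZ; apply: eq_expect => y; rewrite -expRD /update addrAC.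
rewrite expect_sum; apply: eq_bigr => m mw.
by rewrite expectZ (expect_info_dens_indep W_channel W_ac PX_distr mw) mulr1.
Qed.

(** A right decision has [D w] already at [gamma1]; a wrong one makes [wrong_mass] at least 1, which
    pays for the rejection test and the extra climb to [gamma2]. *)
Lemma enter_confirm_time w D :
  scheme_time w (enter_confirm D) <= scheme_time w (Comm1 D).
Proof.
rewrite /enter_confirm; case: pickP => [m Sm|//] /=.
have H1 := hitC_ge0 (gamma2 - gamma1).
have H2 := hitC_ge0 (gamma1 - D w).
have H3 := hitA_ge0 aA; have H4 := hitR_ge0 aR.
have H5 := expR_ge0 (- aR); have H6 := wrong_mass_ge0 D w gamma1.
have H7 := mulr_ge0 H6 (addr_ge0 H1 H4); have H8 := mulr_ge0 H5 H1.
have [mw|mw] := eqVneq m w.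
  rewrite subr0 oppr0 add0r.
  have : expR (- aR) * hitC (gamma2 - D w) <= expR (- aR) * hitC (gamma2 - gamma1).
    by rewrite ler_wpM2l// le_hitC// lerD2l lerN2 -mw.
  by lra.
rewrite addr0.
have : hitC (gamma2 - D w) <= hitC (gamma1 - D w) + hitC (gamma2 - gamma1).
  have -> : gamma2 - D w = (gamma1 - D w) + (gamma2 - gamma1) by ring.
  by apply: (hit_subadd JD muC_gt0); rewrite subr_ge0 ltW.
have := ler_peMl (addr_ge0 H1 H4) (wrong_mass_ge1 mw Sm).
by lra.
Qed.

Lemma enter_confirm_err w D :
  scheme_err w (enter_confirm D) <= scheme_err w (Comm1 D).
Proof.
rewrite /enter_confirm; case: pickP => [m Sm|//] /=; rewrite lerD2r.
have [mw|mw] := eqVneq m w; first by rewrite mulr_ge0 ?wrong_mass_ge0 ?expR_ge0.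
by rewrite sub0r ler_peMl ?expR_ge0// (wrong_mass_ge1 mw).
Qed.

Lemma scheme_ok_step s v y :
  scheme_ok s -> ~~ scheme_halt s -> scheme_ok (scheme_step s v y).
Proof.
case: s => [D|D m l|D|m] //= _ _.
  rewrite /enter_confirm; case: pickP => [m _|nS m] /=.
    by rewrite oppr_lt0 aA_gt0 aR_gt0.
  by rewrite ltNge nS.
rewrite /after_confirm; case: leP => // lA; case: leP => // lR.
by rewrite /= lR lA.
Qed.

Lemma scheme_time_ge0 w s : 0 <= scheme_time w s.
Proof.
case: s => [D|D m l|D|m] //=; last exact: hitC_ge0.
  by rewrite !addr_ge0 ?mulr_ge0 ?addr_ge0 ?hitC_ge0 ?hitA_ge0 ?hitR_ge0
    ?expR_ge0 ?wrong_mass_ge0.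
by case: ifP => _; rewrite !addr_ge0 ?mulr_ge0 ?hitC_ge0 ?hitA_ge0 ?hitR_ge0 ?expR_ge0.
Qed.

Lemma scheme_err_ge0 w s : 0 <= scheme_err w s.
Proof.
case: s => [D|D m l|D|m] //=; rewrite ?wrong_mass_ge0//.
  by rewrite addr_ge0 ?mulr_ge0 ?expR_ge0 ?wrong_mass_ge0.
by rewrite addr_ge0 ?wrong_mass_ge0//; case: ifP => // _; exact: expR_ge0.
Qed.

Let next_confirm w D m l (f : state -> R) : next w (Confirm D m l) f =
  expect (W (if m == w then xA else xR)) (fun y => f (after_confirm D m (l + llrA y))).
Proof. by rewrite /next /= (expect_cst QD). Qed.

Lemma scheme_time_step w s : scheme_ok s -> ~~ scheme_halt s ->
  1 + next w s (scheme_time w) <= scheme_time w s.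
Proof.
case: s => [D|D m l|D|m] //.
- move=> /= /(_ w) Sw _.
  (* By [enter_confirm_time] the next state may be charged as if still in [Comm1]. *)
  apply: le_trans (_ : 1 + comm w (fun v y => scheme_time w (Comm1 (update D v y))) <= _).
    by rewrite lerD2l; apply: le_comm => v y; exact: enter_confirm_time.
  rewrite /= !commD !comm_cst.

  rewrite -(comm_hitC Sw) commZ comm_wrong_mass; lra.
- move=> /= /andP[lR lA] _; rewrite next_confirm.
  have H0 := hitC_ge0 (gamma2 - D w).
  case: eqP => [->|/eqP mw].
    (* Right decision: under [W xA] the factor [expR (- l)] is a martingale, and at rejection
       [expR (- l - aR)] is at least 1, covering the second phase. *)
    apply: le_trans (_ : 1 + expect (W xA) (fun y => hitA (aA - l - llrA y) +
        expR (- l - aR) * hitC (gamma2 - D w) * expR (llrR y)) <= _).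
      rewrite lerD2l; apply: (le_expect (WD _)) => y _.
      have e : expR (- l - aR) * hitC (gamma2 - D w) * expR (llrR y) =
          expR (- (l + llrA y) - aR) * hitC (gamma2 - D w).
        by rewrite mulrAC -expRD llrRE; congr (expR _ * _); ring.
      rewrite e /after_confirm; case: (leP aA) => [_|_] /=.
        by rewrite addr_ge0 ?hitA_ge0// mulr_ge0 ?expR_ge0.
      case: (leP _ (- aR)) => [l'R|_] /=.
        rewrite ler_wpDl ?hitA_ge0// ler_peMl//.
        by rewrite -expR0 ler_expR; lra.
      by rewrite eqxx opprD addrA.
    rewrite expectD expectZ (expect_likelihood_ratio W_channel W_ac) mulr1.
    by rewrite [in leRHS]/hitA (hitE (WD _) DA_gt0) ?subr_gt0// addrA.
  (* Wrong decision: [- l] climbs to [aR] with steps [llrR]; an acceptance merely ends the run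
     early. *)
  apply: le_trans (_ : 1 + expect (W xR) (fun y => hitR (aR + l - llrR y) +
      hitC (gamma2 - D w)) <= _).
    rewrite lerD2l; apply: (le_expect (WD _)) => y _.
    rewrite /after_confirm; case: (leP aA) => [_|_] /=; first by rewrite addr_ge0 ?hitR_ge0.
    case: (leP _ (- aR)) => [l'R|_] /=; first by rewrite lerDr hitR_ge0.
    by rewrite (negbTE mw) llrRE opprK addrA.
  rewrite expectD (expect_cst (WD _)).
  by rewrite [in leRHS]/hitR (hitE (WD _) DR_gt0) ?addrA// -ltrBlDl sub0r.
- move=> _ /= /existsPn /(_ w); rewrite -ltNge => Sw.
  by rewrite -(comm_hitC Sw).
Qed.

Lemma scheme_err_step w s : scheme_ok s -> ~~ scheme_halt s ->
  next w s (scheme_err w) <= scheme_err w s.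
Proof.
case: s => [D|D m l|D|m] //.
- move=> /= _ _.
  apply: le_trans (_ : comm w (fun v y => scheme_err w (Comm1 (update D v y))) <= _).
    by apply: le_comm => v y; exact: enter_confirm_err.
  rewrite /= commD.
  by rewrite commZ !comm_wrong_mass.
- move=> _ _; rewrite next_confirm /=.
  have H0 := wrong_mass_ge0 D w gamma2.
  case: eqP => [->|/eqP mw].
    rewrite add0r -[leRHS](expect_cst (WD xA)).
    apply: (le_expect (WD _)) => y _; rewrite /after_confirm.
    by case: (leP aA) => _ /=; rewrite ?eqxx//; case: (leP _ (- aR)) => _ //=; rewrite eqxx add0r.
  (* Under [W xR] the ratio [expR l] is a martingale; on acceptance it is at least [expR aA], which
     covers the error. *)
  apply: le_trans (_ : expect (W xR) (fun y => expR (l - aA) * expR (llrA y) +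
      wrong_mass D w gamma2) <= _).
    apply: (le_expect (WD _)) => y _; rewrite -expRD [l - aA + _]addrAC.
    rewrite /after_confirm; case: (leP aA) => [lA|_] /=.
      by rewrite mw ler_wpDr// -expR0 ler_expR subr_ge0.
    case: (leP _ (- aR)) => _ /=; first by rewrite lerDr expR_ge0.
    by rewrite (negbTE mw).
  rewrite expectD expectZ (expect_likelihood_ratio W_channel W_ac) mulr1.
  by rewrite (expect_cst (WD _)).
- by move=> _ _; rewrite -[leRHS]comm_wrong_mass.
Qed.

Lemma scheme_err_halt w s : scheme_ok s -> scheme_halt s ->
  (scheme_dec s != w)%:R <= scheme_err w s.
Proof.
case: s => [D|D m l|D|m] //= _ /existsP[m Sm].
case: pickP => [i Si|/(_ m)]; last by rewrite Sm.
by have [_|iw] := eqVneq i w; rewrite /= ?wrong_mass_ge0// (wrong_mass_ge1 iw).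
Qed.

Lemma wrong_mass0 w g : wrong_mass (fun=> 0) w g = (M%:R - 1) * expR (- g).
Proof.
rewrite /wrong_mass sub0r sumr_const cardC1 card_ord -[LHS]mulr_natl -subn1 natrB//.
by case: (m0) => m; case: (M).
Qed.

(** All levels start at 0; [hit_le_bfun] bounds the four hitting times, whose coefficients are
    nonnegative. *)
Lemma scheme_time_start w : scheme_time w (Comm1 (fun=> 0)) <=
  (gamma1 + bfun (joint_law W PX) (fun xy => info_dens PX W xy.1 xy.2)) / mutual_info PX W
  + ((M%:R - 1) * expR (- gamma1) + expR (- aR)) *
    ((gamma2 - gamma1 + bfun (joint_law W PX) (fun xy => info_dens PX W xy.1 xy.2))
      / mutual_info PX W)
  + (aA + bfun (W xA) llrA) / KLdiv W xA xR
  + (M%:R - 1) * expR (- gamma1) * ((aR + bfun (W xR) llrR) / KLdiv W xR xA).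
Proof.
have C1 := hit_le_bfun JD muC_gt0 gamma1_gt0.
have := hit_le_bfun JD muC_gt0 (u := gamma2 - gamma1); rewrite subr_gt0 => /(_ gamma12) C2.
have A1 := hit_le_bfun (WD xA) DA_gt0 aA_gt0.
have R1 := hit_le_bfun (WD xR) DR_gt0 aR_gt0.
rewrite /= subr0 mutual_infoE.
have := ler_wpM2l (expR_ge0 (- aR)) C2.
have := ler_wpM2l (wrong_mass_ge0 (fun=> 0) w gamma1) (lerD C2 R1).
rewrite wrong_mass0 -/hitC -/hitR -/hitA -/(KLdiv W xA xR) -/(KLdiv W xR xA) in C1 C2 A1 R1 *.
rewrite -/hitC -/hitR; lra.
Qed.

Lemma scheme_code (c time0 : R) (N : nat) :
  0 <= c <= 1 -> (0 < N)%N ->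
  (forall w, scheme_time w (Comm1 (fun=> 0)) <= time0) ->
  exists (k : nat) (PU : 'I_k -> R) (enc : 'I_k -> 'I_M -> seq Y -> X)
    (stp : 'I_k -> seq Y -> bool) (dec : 'I_k -> seq Y -> 'I_M),
    is_VLF_code W PU enc stp dec ((1 - c) * time0)
      (c * (1 - M%:R^-1) + (1 - c) *
        ((M%:R - 1) * (expR (- (gamma1 + aA)) + expR (- gamma2)) + time0 / N%:R)).
Proof.
move=> c01 N0 time_start.
apply: (@machine_code _ _ _ _ _ _ _ _ [ffun=> xA] _ _ _ _ _ _ _ W_channel QD
  scheme_ok_step scheme_time_ge0 scheme_err_ge0 scheme_time_step scheme_err_step
  scheme_err_halt _ _ _ _ m0 (Comm1 (fun=> 0))) => // w.
by rewrite /= !wrong_mass0 mulrDr opprD expRD mulrA.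
Qed.

End Scheme.

(** * Choice of the truncation time and the final code *)

Lemma is_VLF_code_le (R : realType) (X Y : finType) (W : X -> Y -> R) (M k : nat)
    (PU : 'I_k -> R) (enc : 'I_k -> 'I_M -> seq Y -> X) (stp : 'I_k -> seq Y -> bool)
    (dec : 'I_k -> seq Y -> 'I_M) (N N' eps eps' : R) :
  N <= N' -> eps <= eps' ->
  is_VLF_code W PU enc stp dec N eps -> is_VLF_code W PU enc stp dec N' eps'.
Proof.
move=> NN ee [dU [tN te]]; split=> //; split=> T.
  exact: le_trans (tN T) NN.
exact: le_trans (te T) ee.
Qed.

Theorem theorem1 (R : realType) (X Y : finType) (W : X -> Y -> R)
  (M : nat) (gamma1 gamma2 aA aR eps0 : R) (PX : X -> R) (xA xR : X) :
  is_channel W ->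
  (* mutual absolute continuity of the rows, so that all divergences and
     log-likelihood ratios are finite *)
  (forall x x' y, 0 < W x y -> 0 < W x' y) ->
  (0 < M)%N ->
  0 < gamma1 -> gamma1 < gamma2 -> 0 < aA -> 0 < aR ->
  0 < eps0 -> eps0 < 1 ->
  (* P_X capacity-achieving: I(P_X, W) = C = max_Q I(Q, W) *)
  is_distr PX ->
  (forall Q : X -> R, is_distr Q -> mutual_info Q W <= mutual_info PX W) ->
  (* C > 0 (the bound divides by C) *)
  0 < mutual_info PX W ->
  (* (xA, xR) maximizes D(P_{Y|X=x} || P_{Y|X=x'}) *)
  (forall x x' : X, KLdiv W x x' <= KLdiv W xA xR) ->
  let C := mutual_info PX W in
  let b := bfun (fun xy : X * Y => PX xy.1 * W xy.1 xy.2)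
                (fun xy : X * Y => info_dens PX W xy.1 xy.2) in
  let bA := bfun (W xA) (fun y => ln (W xA y / W xR y)) in
  let bR := bfun (W xR) (fun y => ln (W xR y / W xA y)) in
  let eps' := (M%:R - 1) * (expR (- (gamma1 + aA)) + expR (- gamma2)) in
  let N' := (gamma1 + b) / C
          + ((M%:R - 1) * expR (- gamma1) + expR (- aR)) * ((gamma2 - gamma1 + b) / C)
          + (aA + bA) / KLdiv W xA xR
          + (M%:R - 1) * expR (- gamma1) * ((aR + bR) / KLdiv W xR xA) in
  exists N eps : R,
    exists_VLF_code W N M eps /\
    N <= (1 - eps0) * N' /\ eps <= eps0 + (1 - eps0) * eps'.
Proof.
move=> W_channel W_ac M_gt0 g1 g12 aA0 aR0 eps0_gt0 eps0_lt1 PX_distr _ C0 KLmax.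
move=> C b bA bR eps' N'.
have [DA0 DR0] := mutual_info_gt0_KLdiv W_channel W_ac PX_distr KLmax C0.
have eps01 : 0 < 1 - eps0 by rewrite subr_gt0.
have MR0 : 0 < M%:R :> R by rewrite ltr0n.
have M1 : 0 <= M%:R - 1 :> R by rewrite subr_ge0 ler1n.
have b0 : 0 <= b by apply: (bfun_ge0 (joint_law_distr W_channel PX_distr)); rewrite -mutual_infoE.
have bA0 : 0 <= bA by apply: (bfun_ge0 (channel_distr W_channel xA)).
have bR0 : 0 <= bR by apply: (bfun_ge0 (channel_distr W_channel xR)).
have eps'0 : 0 <= eps' by apply: mulr_ge0 => //; rewrite addr_ge0 ?expR_ge0.
have N'0 : 0 < N'.
  have e0 := mulr_ge0 M1 (expR_ge0 (- gamma1)).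
  have t1 : 0 < (gamma1 + b) / C by rewrite divr_gt0// ltr_wpDr.
  have t2 : 0 <= (gamma2 - gamma1 + b) / C.
    by apply: divr_ge0; [rewrite addr_ge0// subr_ge0 ltW|exact: ltW].
  have t3 : 0 <= (aA + bA) / KLdiv W xA xR by rewrite divr_ge0 ?addr_ge0// ltW.
  have t4 : 0 <= (aR + bR) / KLdiv W xR xA by rewrite divr_ge0 ?addr_ge0// ltW.
  have t5 := mulr_ge0 (addr_ge0 e0 (expR_ge0 (- aR))) t2.
  have t6 := mulr_ge0 e0 t4.
  by rewrite /N'; apply: ltr_wpDr => //; apply: ltr_wpDr => //; apply: ltr_wpDr.
pose m0 := Ordinal M_gt0.
have code c n : 0 <= c <= 1 -> (0 < n)%N -> exists (k : nat) (PU : 'I_k -> R)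
    (enc : 'I_k -> 'I_M -> seq Y -> X) (stp : 'I_k -> seq Y -> bool)
    (dec : 'I_k -> seq Y -> 'I_M), is_VLF_code W PU enc stp dec ((1 - c) * N')
      (c * (1 - M%:R^-1) + (1 - c) * (eps' + N' / n%:R)).
  move=> c01 n0; apply: (scheme_code m0 W_channel W_ac g1 g12 aA0 aR0 PX_distr C0 DA0 DR0) => // w.
  exact: scheme_time_start.
(* A code needs [eps < 1]. If the target is at least 1, the blind guess alone ([c = 1]) suffices;
   [1 - 1 / (M + 1)] keeps [eps] positive even for [M = 1]. *)
have [small|large] := ltP (eps0 + (1 - eps0) * eps') 1; last first.
  exists ((1 - eps0) * N'), (1 - M.+1%:R^-1); split; last first.
    by split=> //; apply: le_trans large; rewrite gerBl invr_ge0.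
  split.
  - by rewrite mulr_gt0.
  - by rewrite subr_gt0 invf_lt1 ?ltr1n ?ltr0n.
  - by rewrite gtrBl invr_gt0 ltr0n.
  have := code 1 1%N; rewrite ler01 lexx => /(_ isT isT) [k [PU [enc [stp [dec vlf]]]]].
  exists k, PU, enc, stp, dec; apply: is_VLF_code_le vlf.
    by rewrite subrr mul0r ltW// mulr_gt0.
  by rewrite subrr mul0r addr0 mul1r lerD2l lerN2 lef_pV2 ?posrE ?ltr0n// ler_nat.
exists ((1 - eps0) * N'), (eps0 + (1 - eps0) * eps'); split=> //; split=> //.
- by rewrite mulr_gt0.
- by rewrite ltr_wpDr// mulr_ge0// ltW.
have nb0 : 0 <= M%:R * N' / eps0 by rewrite divr_ge0 ?mulr_ge0// ltW.
(* Large enough for [N' / n <= eps0 / M], so that truncation fits in the slack of the blind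
   guess. *)
pose n := (Num.bound (M%:R * N' / eps0)).+1.
have := code eps0 n; rewrite !ltW// => /(_ isT isT) [k [PU [enc [stp [dec vlf]]]]].
exists k, PU, enc, stp, dec; apply: is_VLF_code_le vlf => //.
have nN : N' / n%:R <= eps0 / M%:R.
  have := ltW (archi_boundP nb0); rewrite ler_pdivrMr// => nb.
  rewrite ler_pdivrMr ?ltr0n// mulrAC ler_pdivlMr// mulrC [leRHS]mulrC.
  by apply: le_trans nb _; rewrite ler_pM2r// ler_nat.
have tN : (1 - eps0) * (N' / n%:R) <= eps0 / M%:R.
  apply: le_trans nN; rewrite ler_piMl ?divr_ge0 ?(ltW N'0)//.
  by rewrite gerBl ltW.
by rewrite mulrBr mulr1 [X in _ + X]mulrDr; lra.
Qed.
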